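(* Let $E/\mathbb Q(t)$ be the elliptic curve $y^2=x^3-(t^2+27)x+10t^2+48t+90$, and let $M\le E(\mathbb Q(t))$ be the subgroup generated by $P=(t+3,4t+6)$ and $Q=(9,t+24)$. Let $t_0\in\mathbb Q$ be such that $E_{t_0}$ is an elliptic curve, $t_0\notin\{-26,-19,-12,-11,-5,-3,-1,6,9,44\}$, and the polynomial $x^3-(t_0^2+27)x+10t_0^2+48t_0+90$ has no rational roots. Then the restricted specialization map $\sigma_{t_0}|_M:M\to E_{t_0}(\mathbb Q)$ is injective.
   Context: $E_{t_0}$ denotes the curve $y^2=x^3-(t_0^2+27)x+10t_0^2+48t_0+90$ over $\mathbb Q$, and $\sigma_{t_0}:E(\mathbb Q(t))\to E_{t_0}(\mathbb Q)$ is the specialization homomorphism $(x(t),y(t))\mapsto(x(t_0),y(t_0))$, $O\mapsto O$. *)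

(* Defs.v *)
From HB Require Import structures.
From mathcomp Require Import all_boot all_order all_algebra fraction.
Set Implicit Arguments. Unset Strict Implicit. Unset Printing Implicit Defensive.
Import Order.TTheory GRing.Theory Num.Theory.
Local Open Scope ring_scope.

Inductive point (K : Type) := Inf | Aff of K & K.
Arguments Inf {K}.

Section Weierstrass.
Variable K : fieldType.
Variables a b : K.

Definition on_curve (P : point K) : bool :=
  match P with
  | Inf => true
  | Aff x y => y ^+ 2 == x ^+ 3 + a * x + b
  end.

Definition negp (P : point K) : point K :=
  match P with Inf => Inf | Aff x y => Aff x (- y) end.

Definition addp (P Q : point K) : point K :=
  match P, Q with
  | Inf, _ => Q
  | _, Inf => P
  | Aff x1 y1, Aff x2 y2 =>
    if x1 == x2 then
      if y1 + y2 == 0 then Inf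
      else let l := (3%:R * x1 ^+ 2 + a) / (2%:R * y1) in
           let x3 := l ^+ 2 - x1 - x2 in Aff x3 (l * (x1 - x3) - y1)
    else let l := (y2 - y1) / (x2 - x1) in
         let x3 := l ^+ 2 - x1 - x2 in Aff x3 (l * (x1 - x3) - y1)
  end.

Definition mulpn (n : nat) (P : point K) : point K := iter n (addp P) Inf.
Definition mulpz (n : int) (P : point K) : point K :=
  match n with
  | Posz k => mulpn k P
  | Negz k => negp (mulpn k.+1 P)
  end.
End Weierstrass.

Definition Qt := {fraction {poly rat}}.
Definition polyF (p : {poly rat}) : Qt := @FracField.tofrac _ p.

Definition aE : {poly rat} := - ('X ^+ 2 + 27%:R%:P).
Definition bE : {poly rat} := 10%:R *: 'X ^+ 2 + 48%:R *: 'X + 90%:R%:P.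

Definition a0 (t0 : rat) : rat := - (t0 ^+ 2 + 27%:R).
Definition b0 (t0 : rat) : rat := 10%:R * t0 ^+ 2 + 48%:R * t0 + 90%:R.

Definition fibre_elliptic (t0 : rat) : Prop :=
  4%:R * a0 t0 ^+ 3 + 27%:R * b0 t0 ^+ 2 != 0.

Definition PE : point Qt :=
  Aff (polyF ('X + 3%:R%:P)) (polyF (4%:R *: 'X + 6%:R%:P)).
Definition QE : point Qt :=
  Aff (polyF 9%:R%:P) (polyF ('X + 24%:R%:P)).

Definition inM (R : point Qt) : Prop :=
  exists n m : int, R = addp (polyF aE) (mulpz (polyF aE) n PE) (mulpz (polyF aE) m QE).

Definition regular_value (t0 : rat) (f : Qt) (v : rat) : Prop :=
  exists p q : {poly rat}, q.[t0] != 0 /\ f = polyF p / polyF q /\ v = p.[t0] / q.[t0].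

Definition regular_at (t0 : rat) (f : Qt) : Prop := exists v, regular_value t0 f v.

(* The specialization map sigma_{t0} : E(Q(t)) -> E_{t0}(Q), as a (functional)
   relation: (x(t),y(t)) |-> (x(t0),y(t0)) when x, y are regular at t0,
   O |-> O, and points whose coordinates have a pole at t0 reduce to O. *)
Definition spec (t0 : rat) (R : point Qt) (S : point rat) : Prop :=
  match R, S with
  | Inf, Inf => True
  | Inf, Aff _ _ => False
  | Aff x y, Aff u v => regular_value t0 x u /\ regular_value t0 y v
  | Aff x y, Inf => ~ regular_at t0 x \/ ~ regular_at t0 y
  end.

(* Main.v *)
From Stdlib Require Import ZArith.
Require Import Defs.
From HB Require Import structures.
From mathcomp Require Import all_boot all_order all_algebra.
From mathcomp Require Import fraction generic_quotient.
From mathcomp Require Import ring ssrZ zify.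
Set Implicit Arguments. Unset Strict Implicit. Unset Printing Implicit Defensive.
Import Order.TTheory GRing.Theory Num.Theory.
Local Open Scope ring_scope.

(** Specialization at [t0] is a homomorphism, so it suffices that the images
    [P0], [Q0] of [P], [Q] are linearly independent.  As [E_t0] has no rational
    2-torsion, dividing a relation by 2 as long as possible leaves one of
    [P0], [Q0], [P0 + Q0] in [2 E_t0(Q)].  The tangent at a half of one of these
    points has a rational slope [l], and [t0] is a root of a quadratic equation
    whose coefficients are polynomials in [l] and whose discriminant is, up to
    squares, [2 l (l-2) (l-3) (l-7)], [-(l-1) (l-3) (l-5) (l+9)] or
    [2 l (l-2) (l+3) (l+5)].  Each of these, made equal to a square, defines an
    elliptic curve with full 2-torsion whose only rational points are the 2-torsion
    points; these give the ten excluded values of [t0].  That there is no other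
    point is a 2-descent: all 2-coverings outside the image of the 2-torsion have
    a local obstruction at [oo], 2, 3, 5 or 7, so every point is the sum of a
    2-torsion point and of a double; a double has an abscissa with an even
    denominator, hence halving strictly decreases the 2-adic valuation of the
    denominator, forever. *)

(** * The group law *)

Section GroupLaw.
Variables (K : fieldType) (a b : K).
Hypothesis two_neq0 : 2%:R != 0 :> K.
Hypothesis no_root : forall x : K, x ^+ 3 + a * x + b != 0.

Local Notation "P +' Q" := (addp a P Q) (at level 50, left associativity).
Local Notation oc := (on_curve a b).

(** Both equations hold for the slope of a chord and for that of a tangent. The first determines [l]
    when [x1 <> x2], the second when [y1 + y2 <> 0], so chords and tangents need no separate
    treatment later. *)
Definition slope_rel (x1 y1 x2 y2 l : K) : Prop :=
  l * (x2 - x1) = y2 - y1 /\ l * (y1 + y2) = x1 ^+ 2 + x1 * x2 + x2 ^+ 2 + a.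

Definition third (l x1 y1 x2 : K) : point K :=
  Aff (l ^+ 2 - x1 - x2) (l * (x1 - (l ^+ 2 - x1 - x2)) - y1).

Lemma on_curve_y_neq0 x y : oc (Aff x y) -> y != 0.
Proof.
move=> /= /eqP e; apply/eqP => y0; move: (no_root x).
by rewrite -e y0 expr0n eqxx.
Qed.

Lemma addp_opp x y : Aff x y +' Aff x (- y) = Inf.
Proof. by rewrite /= eqxx addrN eqxx. Qed.

Lemma addp_third x1 y1 x2 y2 l : oc (Aff x1 y1) -> oc (Aff x2 y2) ->
  Aff x2 y2 <> negp (Aff x1 y1) -> slope_rel x1 y1 x2 y2 l ->
  Aff x1 y1 +' Aff x2 y2 = third l x1 y1 x2.
Proof.
move=> /= /eqP e1 /eqP e2 nopp [s1 s2]; rewrite /third.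
case: eqVneq => [ex|nx]; last first.
  have nz : x2 - x1 != 0 by rewrite subr_eq0 eq_sym.
  by have -> : (y2 - y1) / (x2 - x1) = l by rewrite -s1 mulfK.
case: eqVneq => [ey|ny].
  by case: nopp; rewrite ex; congr Aff; apply/eqP; rewrite -addr_eq0 addrC ey.
have ey : y2 = y1 by apply/eqP; rewrite -subr_eq0 -s1 ex subrr mulr0.
have nz : 2%:R * y1 != 0 by move: ny; rewrite ey mulr_natl mulr2n.
suff -> : (3%:R * x1 ^+ 2 + a) / (2%:R * y1) = l by [].
apply: (canLR (mulfK nz)); move: s2; rewrite -ex ey => s2.
have -> : l * (2%:R * y1) = l * (y1 + y1) by ring.
by rewrite s2; ring.
Qed.

Lemma slope_exists x1 y1 x2 y2 : oc (Aff x1 y1) -> oc (Aff x2 y2) ->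
  Aff x2 y2 <> negp (Aff x1 y1) -> exists l, slope_rel x1 y1 x2 y2 l.
Proof.
move=> /= /eqP e1 /eqP e2 nopp.
have [ex|nx] := eqVneq x1 x2.
  have ny : y1 + y2 != 0.
    apply/eqP => h; case: nopp; rewrite ex; congr Aff.
    by apply/eqP; rewrite -addr_eq0 addrC h.
  exists ((x1 ^+ 2 + x1 * x2 + x2 ^+ 2 + a) / (y1 + y2)); split; last by rewrite divfK.
  rewrite ex subrr mulr0; apply/eqP; rewrite eq_sym.
  rewrite -(mulIr_eq0 _ (mulIf ny)).
  have -> : (y2 - y1) * (y1 + y2) = y2 ^+ 2 - y1 ^+ 2 by ring.
  by rewrite e1 e2 ex subrr.
have nz : x2 - x1 != 0 by rewrite subr_eq0 eq_sym.
exists ((y2 - y1) / (x2 - x1)); split; first by rewrite divfK.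
apply: (mulIf nz); rewrite mulrAC divfK //.
have -> : (y2 - y1) * (y1 + y2) = y2 ^+ 2 - y1 ^+ 2 by ring.
by rewrite e1 e2; ring.
Qed.

(** Restricted to the line, the equation is a monic cubic in [x] with roots [x1] and [x2]; its
    coefficient of [x^2] gives the third root. *)
Lemma line_factor x1 y1 x2 y2 l x : oc (Aff x1 y1) -> slope_rel x1 y1 x2 y2 l ->
  x ^+ 3 + a * x + b =
  (y1 + l * (x - x1)) ^+ 2 + (x - x1) * (x - x2) * (x - (l ^+ 2 - x1 - x2)).
Proof.
move=> /= /eqP e1 [s1 s2].
have ey : y2 = y1 + l * (x2 - x1) by rewrite s1; ring.
move: s2; rewrite ey => s2.
have -> : b = y1 ^+ 2 - x1 ^+ 3 - a * x1 by rewrite e1; ring.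
have -> : a = l * (y1 + (y1 + l * (x2 - x1))) - (x1 ^+ 2 + x1 * x2 + x2 ^+ 2).
  by rewrite s2; ring.
by ring.
Qed.

Variant addp_spec : point K -> point K -> point K -> Prop :=
| Addp0l B : addp_spec Inf B B
| Addp0r A : addp_spec A Inf A
| AddpN x y : oc (Aff x y) -> addp_spec (Aff x y) (Aff x (- y)) Inf
| AddpA x1 y1 x2 y2 l : oc (Aff x1 y1) -> oc (Aff x2 y2) ->
    Aff x2 y2 <> negp (Aff x1 y1) -> slope_rel x1 y1 x2 y2 l ->
    addp_spec (Aff x1 y1) (Aff x2 y2) (third l x1 y1 x2).

Lemma addpP A B : oc A -> oc B -> addp_spec A B (A +' B).
Proof.
case: A => [|x1 y1]; first by move=> _ _; constructor.
case: B => [|x2 y2]; first by move=> _ _; constructor.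
move=> o1 o2.
have [[->] ->|nopp] : Aff x2 y2 = negp (Aff x1 y1) \/ Aff x2 y2 <> negp (Aff x1 y1).
- have [->|/eqP n1] := eqVneq x2 x1; last by right; case.
  by have [->|/eqP n2] := eqVneq y2 (- y1); [left|right; case].
- by rewrite addp_opp; constructor.
have [l sl] := slope_exists o1 o2 nopp.
by rewrite (addp_third o1 o2 nopp sl); constructor.
Qed.

Lemma on_curve_negp (A : point K) : oc A -> oc (negp A).
Proof. by case: A => //= x y; rewrite sqrrN. Qed.

Lemma negpK (A : point K) : negp (negp A) = A.
Proof. by case: A => //= x y; rewrite opprK. Qed.

Lemma on_curve_addp A B : oc A -> oc B -> oc (A +' B).
Proof.
move=> oA oB; have sp := addpP oA oB; case: sp oA oB => // x1 y1 x2 y2 l o1 o2 _ sl _ _ /=.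
apply/eqP; rewrite (line_factor _ o1 sl) subrr mulr0 addr0; ring.
Qed.

Lemma slope_relC x1 y1 x2 y2 l : slope_rel x1 y1 x2 y2 l -> slope_rel x2 y2 x1 y1 l.
Proof.
case=> s1 s2; split; first by rewrite -(opprB x2) mulrN s1 opprB.
by rewrite addrC s2; ring.
Qed.

Lemma addpC A B : oc A -> oc B -> A +' B = B +' A.
Proof.
move=> oA oB; have sp := addpP oA oB; case: sp oA oB => [{}B|{}A|x y|x1 y1 x2 y2 l]; do ?by [case: B|case: A].
  by move=> _ _ _; rewrite -{2}(opprK y) addp_opp.
move=> o1 o2 nopp sl _ _; rewrite (@addp_third x2 y2 x1 y1 l) //; last exact: slope_relC.
  by case: sl => s1 _; rewrite /third; congr Aff; [ring|];
  have -> : y2 = y1 + l * (x2 - x1) by [rewrite s1; ring]; ring.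
by move=> h; apply: nopp; rewrite h negpK.
Qed.

Lemma negp_addp A B : oc A -> oc B -> negp (A +' B) = negp A +' negp B.
Proof.
move=> oA oB; have sp := addpP oA oB; case: sp oA oB => [{}B|{}A|x y|x1 y1 x2 y2 l]; do ?by [case: B|case: A].
  by move=> _ _ _; exact: (esym (addp_opp x (- y))).
move=> o1 o2 nopp sl _ _; rewrite [negp (Aff x1 y1)]/= [negp (Aff x2 y2)]/=.
have [o1' o2'] := (on_curve_negp o1, on_curve_negp o2).
rewrite (@addp_third x1 (- y1) x2 (- y2) (- l)) //.
- by rewrite /third sqrrN /=; congr Aff; ring.
- by move=> /(congr1 (@negp K)); rewrite negpK /= opprK => h; apply: nopp.
- by case: sl => s1 s2; split; [rewrite mulNr s1; ring | rewrite -s2; ring].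
Qed.

(** Mirroring the line through [A] and [B] gives a line of slope [- l] through [A + B], [- B] and
    [- A]. This precedes associativity, whose degenerate cases rest on it. *)
Lemma addpK A B : oc A -> oc B -> (A +' B) +' negp B = A.
Proof.
move=> oA oB; have oAB := on_curve_addp oA oB.
have sp := addpP oA oB; case: sp oA oB oAB => [{}B|{}A|x y|x1 y1 x2 y2 l] //.
- by case: B => //= x y; rewrite eqxx addrN eqxx.
- by case: A.
- by move=> _ _ _ _; rewrite /= opprK.
move=> o1 o2 nopp [s1 s2] _ _ o3.
have ey : y2 = y1 + l * (x2 - x1) by rewrite s1; ring.
rewrite [negp _]/= (@addp_third _ _ _ _ (- l)) //; last first.
- split; first by rewrite ey; ring.
  have -> : a = l * (y1 + y2) - (x1 ^+ 2 + x1 * x2 + x2 ^+ 2) by rewrite s2; ring.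
  by rewrite ey; ring.
(* If [A + B = B], the line takes both values [y2] and [- y2] at [x2], so [2 y2 = 0], against the
   absence of 2-torsion. *)
- rewrite /= => -[e3 e4]; have := on_curve_y_neq0 o2; apply/negP; rewrite negbK.
  rewrite -(mulrI_eq0 _ (mulfI two_neq0)); apply/eqP.
  move: (oppr_inj e4); rewrite -e3 => e5.
  have -> : 2%:R * y2 = y2 + y2 by ring.
  by rewrite {1}e5 ey; ring.
- exact: on_curve_negp o2.
by rewrite /third; congr Aff; rewrite ?ey; ring.
Qed.

(* With [l], [m] the slopes of the lines through [A, B] and [B, C], the line
   through [A + B] and [C] has slope [(x3 - x1) / (m - l) - l], also when it is
   a tangent: both equations of [slope_rel] hold identically. *)
Lemma slope_addp x1 y1 x2 y2 x3 y3 l m : oc (Aff x2 y2) ->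
  slope_rel x1 y1 x2 y2 l -> slope_rel x2 y2 x3 y3 m -> m - l != 0 ->
  let x4 := l ^+ 2 - x1 - x2 in
  slope_rel x4 (l * (x1 - x4) - y1) x3 y3 ((x3 - x1) / (m - l) - l).
Proof.
move=> o2 [s1 s2] [s3 s4] nz x4.
have ey1 : y1 = y2 - l * (x2 - x1) by rewrite s1; ring.
have ey3 : y3 = y2 + m * (x3 - x2) by rewrite s3; ring.
have ea : a = l * (y1 + y2) - (x1 ^+ 2 + x1 * x2 + x2 ^+ 2) by rewrite s2; ring.
have : m * (y2 + y3) = x2 ^+ 2 + x2 * x3 + x3 ^+ 2 +
   (l * (y1 + y2) - (x1 ^+ 2 + x1 * x2 + x2 ^+ 2)) by rewrite -ea s4.
rewrite ey1 ey3 => e.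
have ey2 : y2 = (x2 ^+ 2 + x2 * x3 + x3 ^+ 2 - l * l * (x2 - x1)
   - (x1 ^+ 2 + x1 * x2 + x2 ^+ 2) - m * m * (x3 - x2)) / (2%:R * (m - l)).
  apply: (canRL (mulfK _)); first by rewrite mulf_neq0.
  have -> : y2 * (2%:R * (m - l)) =
    m * (y2 + (y2 + m * (x3 - x2))) - m * m * (x3 - x2) - l * (2%:R * y2) by ring.
  by rewrite e; ring.
split; rewrite /x4 ?ea ?ey1 ?ey3 ey2; field; rewrite nz; exact: two_neq0.
Qed.

Lemma collinear_third x1 y1 x2 y2 x3 l : oc (Aff x1 y1) ->
  slope_rel x1 y1 x2 y2 l -> oc (Aff x3 (y1 + l * (x3 - x1))) ->
  [\/ x3 = x1, x3 = x2 | x3 = l ^+ 2 - x1 - x2].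
Proof.
move=> o1 sl /= /eqP o3; have := line_factor x3 o1 sl; rewrite -o3.
rewrite -{1}[_ ^+ 2]addr0 => /addrI/esym/eqP; rewrite !mulf_eq0 !subr_eq0 -orbA.
by case/or3P => /eqP; [constructor 1|constructor 2|constructor 3].
Qed.

Lemma addpN A : A +' negp A = Inf.
Proof. by case: A => // x y; apply: addp_opp. Qed.

Lemma point_dec (A B : point K) : A = B \/ A <> B.
Proof.
case: A B => [|x y] [|x' y']; [by left|by right|by right|].
have [<-|n1] := eqVneq x x'; last by right; case=> /eqP; rewrite (negPf n1).
have [<-|n2] := eqVneq y y'; first by left.
by right; case=> /eqP; rewrite (negPf n2).
Qed.

Lemma addpA A B C : oc A -> oc B -> oc C -> A +' (B +' C) = (A +' B) +' C.
Proof.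
move=> oA oB oC; have oAB := on_curve_addp oA oB; have oBC := on_curve_addp oB oC.
(* First the four cases in which an inner sum or the total is [Inf]; each reduces to
   cancellation. *)
have [e|n1] := point_dec B (negp A).
  have eA : A = negp B by rewrite e negpK.
  rewrite (addpC oA oBC) (addpC oB oC) eA addpK //.
  by rewrite (addpC _ oB) ?addpN ?on_curve_negp.
have [e|n2] := point_dec C (negp B).
  by rewrite e addpN addpK //; case: (A).
have [e|n3] := point_dec C (negp (A +' B)).
  suff h : B +' negp (A +' B) = negp A by rewrite e h !addpN.
  rewrite -[in RHS](addpK oA oB) (negp_addp oAB (on_curve_negp oB)) negpK.
  by rewrite addpC ?on_curve_negp.
have [e|n4] := point_dec A (negp (B +' C)).
  suff h : A +' B = negp C by rewrite h e !(addpC (on_curve_negp _)) // !addpN.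
  rewrite -[in RHS](addpK oC oB) negp_addp ?on_curve_negp ?on_curve_addp // negpK e.
  by rewrite (addpC oC oB).
case: A oA oAB n1 n3 n4 => [//|x1 y1] o1 oAB n1 n3 n4.
case: B oB oAB oBC n1 n2 n3 n4 => [//|x2 y2] o2 oAB oBC n1 n2 n3 n4.
case: C oC oBC n2 n3 n4 => [|x3 y3] o3 oBC n2 n3 n4; first by case: (_ +' _).
have [l sl] := slope_exists o1 o2 n1.
have [m sm] := slope_exists o2 o3 n2.
have e12 := addp_third o1 o2 n1 sl; have e23 := addp_third o2 o3 n2 sm.
rewrite e12 in oAB n3 *; rewrite e23 in oBC n4 *.
have ey2 : y2 = y1 + l * (x2 - x1) by case: sl => -> _; ring.
have ey3 : y3 = y2 + m * (x3 - x2) by case: sm => -> _; ring.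
(* Equal slopes put [A], [B], [C] on one line. Then [C = A], where commutativity suffices, or [C] or
   [A] is the opposite of the sum of the other two, which is excluded. *)
have [elm|nz] := eqVneq m l.
  suff e : x3 = x1.
    have ey : y3 = y1 by rewrite ey3 ey2 elm e; ring.
    by rewrite -e12 -e23 e ey addpC ?on_curve_addp // (addpC o1 o2).
  have oo3 : oc (Aff x3 (y1 + l * (x3 - x1))).
    by have -> : y1 + l * (x3 - x1) = y3 by rewrite ey3 ey2 elm; ring.
  have oo1 : oc (Aff x1 (y3 + m * (x1 - x3))).
    by have -> : y3 + m * (x1 - x3) = y1 by rewrite ey3 ey2 elm; ring.
  case: (collinear_third o1 sl oo3) => // e.
    case: (collinear_third o3 (slope_relC sm) oo1) => // e'; first by rewrite e e'.
    case: n4; rewrite /third /=; congr Aff; first by rewrite e'; ring.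
    have -> : y1 = y2 + m * (x1 - x2) by rewrite ey2 elm; ring.
    by rewrite e' ; ring.
  case: n3; rewrite /third /=; congr Aff => //.
  by rewrite ey3 ey2 elm e; ring.
have nz1 : m - l != 0 by rewrite subr_eq0.
have nz2 : l - m != 0 by rewrite subr_eq0 eq_sym.
(* For distinct slopes both outer sums have explicit slopes. The second application reads the triple
   as [C], [B], [A], hence the rewriting of [B + C] as [C + B] below. *)
have s4 := slope_addp o2 sl sm nz1.
have s5 := slope_addp o2 (slope_relC sm) (slope_relC sl) nz2.
rewrite (addp_third _ _ n3 s4) // (addpC o1) //.
have e32 : third m x2 y2 x3 = third m x3 y3 x2.
  by rewrite /third; congr Aff; [|rewrite ey3]; ring.
rewrite e32 in oBC n4 *.
rewrite (addp_third _ _ n4 s5) //.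
by rewrite /third; congr Aff; rewrite ?ey3 ?ey2; field; rewrite nz1 nz2.
Qed.
End GroupLaw.

(** * The abelian group of points of a curve without 2-torsion *)

Definition point_opt (K : Type) (A : point K) : option (K * K) :=
  if A is Aff x y then Some (x, y) else None.
Definition opt_point (K : Type) (o : option (K * K)) : point K :=
  if o is Some (x, y) then Aff x y else Inf.
Lemma point_optK (K : Type) : cancel (@point_opt K) (@opt_point K).
Proof. by case. Qed.

HB.instance Definition _ (K : choiceType) := Choice.copy (point K) (can_type (@point_optK K)).

Definition no_two_torsion (K : fieldType) (a b : K) : Prop :=
  2%:R != 0 :> K /\ forall x : K, x ^+ 3 + a * x + b != 0.

(* The proof [h] is a parameter of the type so that the group structure, which
   needs it, can be inferred from the carrier. *)
Definition ecurve (K : fieldType) (a b : K) (h : no_two_torsion a b) : Type :=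
  {P : point K | on_curve a b P}.

Section Ecurve.
Variables (K : fieldType) (a b : K) (h : no_two_torsion a b).
Local Notation E := (ecurve h).
HB.instance Definition _ := SubType.copy E {P : point K | on_curve a b P}.
HB.instance Definition _ := Choice.copy E {P : point K | on_curve a b P}.

Definition ec_add (P Q : E) : E := Sub (addp a (val P) (val Q)) (on_curve_addp (valP P) (valP Q)).
Definition ec_opp (P : E) : E := Sub (negp (val P)) (on_curve_negp (valP P)).
Definition ec_zero : E := Sub (Inf : point K) (erefl true : on_curve a b Inf).

Lemma ec_addA : associative ec_add.
Proof. by move=> P Q R; apply: val_inj; apply: (addpA h.1 h.2); apply: valP. Qed.
Lemma ec_addC : commutative ec_add.
Proof. by move=> P Q; apply: val_inj; apply: addpC; apply: valP. Qed.
Lemma ec_add0 : left_id ec_zero ec_add.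
Proof. by move=> P; apply: val_inj. Qed.
Lemma ec_addN : left_inverse ec_zero ec_opp ec_add.
Proof. by move=> P; rewrite ec_addC; apply: val_inj; apply: addpN. Qed.

HB.instance Definition _ := GRing.isZmodule.Build E ec_addA ec_addC ec_add0 ec_addN.

Lemma val_ecD (P Q : E) : val (P + Q) = addp a (val P) (val Q).
Proof. by []. Qed.
Lemma val_ecN (P : E) : val (- P) = negp (val P).
Proof. by []. Qed.

Lemma val_ecM (P : E) (n : nat) : val (P *+ n) = mulpn a n (val P).
Proof. by elim: n => [//|n IH]; rewrite mulrS val_ecD IH. Qed.
Lemma val_ecMz (P : E) (n : int) : val (P *~ n) = Defs.mulpz a n (val P).
Proof.
case: n => n; rewrite /intmul; first exact: val_ecM.
by rewrite val_ecN val_ecM.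
Qed.

Lemma ec_double_eq0 (P : E) : P *+ 2 = 0 -> P = 0.
Proof.
rewrite mulr2n => /eqP; rewrite addr_eq0 => /eqP e; apply: val_inj.
have := congr1 val e; case: P {e} => [[//|x y] o] /= [] /eqP.
rewrite -addr_eq0 -mulr2n -mulr_natl mulf_eq0 (negPf h.1) /=.
by rewrite (negPf (on_curve_y_neq0 h.2 o)).
Qed.
End Ecurve.

(** Induction on a bound for [|n| + |m|]. The parities of [n] and [m] exhibit 0, [p], [q] or [p + q]
    as a double; only 0 is possible, and then the relation can be halved since there is no
    2-torsion. *)
Lemma free_of_not_double (G : zmodType) (p q : G) :
  (forall x : G, x *+ 2 = 0 -> x = 0) ->
  (forall x, x *+ 2 <> p) -> (forall x, x *+ 2 <> q) -> (forall x, x *+ 2 <> p + q) ->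
  forall n m : int, p *~ n + q *~ m = 0 -> n = 0 /\ m = 0.
Proof.
move=> tf hp hq hpq n m.
have [k le_k] : exists k, (absz n + absz m <= k)%N by exists (absz n + absz m)%N.
elim: k n m le_k => [|k IH] n m; first by lia.
move=> le_k e.
have half (z : int) : exists (w : int) (c : bool), z = w * 2 + c%:Z.
  by exists (z %/ 2)%Z, (z %% 2 == 1)%Z; lia.
have [n' [c en]] := half n; have [m' [d em]] := half m.
have e2 : - (p *~ n' + q *~ m') *+ 2 = p *~ c + q *~ d.
  have dbl (x : G) (w : int) : x *~ (w * 2) = x *~ w *+ 2 by rewrite mulrzA.
  apply/eqP; rewrite mulNrn eq_sym -addr_eq0 mulrnDl -!dbl.
  by rewrite addrC addrACA -!mulrzDr -en -em e.
case: c d en em e2 => [] [] /= en em.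
- by rewrite !mulr1z => /hpq.
- by rewrite mulr0z addr0 mulr1z => /hp.
- by rewrite mulr0z add0r mulr1z => /hq.
rewrite !mulr0z addr0 => /tf/eqP; rewrite oppr_eq0 => /eqP e0.
by have := IH n' m' _ e0; lia.
Qed.

(** * Reduction at a place *)

(** The graph of a place of [K] with values in [k], a relation because poles have no value.
    [place_total] is the valuation ring axiom. *)
Record is_place (K k : fieldType) (V : K -> k -> Prop) : Prop := IsPlace {
  place1 : V 1 1;
  placeN : forall f v, V f v -> V (- f) (- v);
  placeD : forall f g v w, V f v -> V g w -> V (f + g) (v + w);
  placeM : forall f g v w, V f v -> V g w -> V (f * g) (v * w);
  place_uniq : forall f v w, V f v -> V f w -> v = w;
  place_total : forall f, (exists v, V f v) \/ V f^-1 0 }.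

Section Place.
Variables (K k : fieldType) (V : K -> k -> Prop).
Hypothesis pl : is_place V.

Lemma placeB f g v w : V f v -> V g w -> V (f - g) (v - w).
Proof. by move=> hf /(placeN pl); apply: (placeD pl). Qed.
Lemma place0 : V 0 0.
Proof. by have := placeB (place1 pl) (place1 pl); rewrite !subrr. Qed.
Lemma placeX f v n : V f v -> V (f ^+ n) (v ^+ n).
Proof.
move=> hf; elim: n => [|n IH]; first exact: (place1 pl).
by rewrite !exprS; apply: (placeM pl).
Qed.
Lemma place_nat n : V n%:R n%:R.
Proof.
elim: n => [|n IH]; first exact: place0.
by rewrite -!natr1; apply: (placeD pl) => //; apply: (place1 pl).
Qed.
Lemma place_congr f g v w : V f v -> f = g -> v = w -> V g w.
Proof. by move=> h <- <-. Qed.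
Lemma place_neq0 f v : V f v -> v != 0 -> f != 0.
Proof.
move=> hf; apply: contraNneq => f0; rewrite f0 in hf.
by apply/eqP; apply: (place_uniq pl hf place0).
Qed.
Lemma placeV f v : V f v -> v != 0 -> V f^-1 v^-1.
Proof.
move=> hf nv; have nf := place_neq0 hf nv.
case: (place_total pl f^-1) => [[w hw]|]; last first.
  rewrite invrK => h0; have := place_uniq pl hf h0 => v0.
  by rewrite v0 eqxx in nv.
have := placeM pl hf hw; rewrite mulfV // => h1.
have e : v * w = 1 := place_uniq pl h1 (place1 pl).
by have -> : v^-1 = w by rewrite -[w](mulKf nv) e mulr1.
Qed.
Lemma placeMV f g v w : V f v -> V g w -> w != 0 -> V (f / g) (v / w).
Proof. by move=> hf hg nw; apply: (placeM pl) => //; apply: placeV. Qed.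

Variables (a b : K) (a' b' : k).
Hypotheses (ha : V a a') (hb : V b b').
Hypothesis nt' : no_two_torsion a' b'.

(** A regular root would reduce to a root of the reduced cubic. At a pole, the cubic divided by
    [x^3] reduces to 1. This provides the group law on the generic fibre. *)
Lemma place_root_free : no_two_torsion a b.
Proof.
split; first exact: place_neq0 (place_nat 2) nt'.1.
move=> x; case: (place_total pl x) => [[v hv]|hx].
  have := placeD pl (placeD pl (placeX 3 hv) (placeM pl ha hv)) hb.
  by move=> h; apply: place_neq0 h (nt'.2 v).
(* Since [0^-1 = 0], the second alternative of [place_total] also holds at 0, which is not a
   pole. *)
have [->|nx] := eqVneq x 0.
  rewrite expr0n mulr0 !add0r /=; have := nt'.2 0.
  by rewrite expr0n mulr0 !add0r /=; apply: place_neq0.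
have h := placeD pl (placeD pl (place1 pl) (placeM pl ha (placeX 2 hx)))
            (placeM pl hb (placeX 3 hx)).
have nz : 1 + a * x^-1 ^+ 2 + b * x^-1 ^+ 3 != 0.
  by apply: place_neq0 h _; rewrite !expr0n !mulr0 !addr0 oner_eq0.
have -> : x ^+ 3 + a * x + b = x ^+ 3 * (1 + a * x^-1 ^+ 2 + b * x^-1 ^+ 3) by field.
by rewrite mulf_neq0 // expf_neq0.
Qed.

Definition regular f := exists v, V f v.
Definition red (R : point K) (S : point k) : Prop :=
  match R, S with
  | Inf, Inf => True
  | Inf, Aff _ _ => False
  | Aff x y, Aff u v => V x u /\ V y v
  | Aff x y, Inf => ~ regular x \/ ~ regular y
  end.

Let nt := place_root_free.
Local Notation "P +' Q" := (addp a P Q) (at level 50, left associativity).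
Local Notation oc := (on_curve a b).
Local Notation oc' := (on_curve a' b').

Lemma place_sqr_regular f : regular (f ^+ 2) -> regular f.
Proof.
case=> v hv; case: (place_total pl f) => // hf.
have [->|nf] := eqVneq f 0; first by exists 0; apply: place0.
have := placeM pl hv (placeX 2 hf).
rewrite -exprMn mulfV // expr1n expr0n mulr0 => h.
by have /eqP := place_uniq pl h (place1 pl); rewrite eq_sym oner_eq0.
Qed.

Lemma nonregular_inv f : ~ regular f -> V f^-1 0.
Proof. by case: (place_total pl f) => // h []. Qed.

Lemma on_curve_regular_y x y : oc (Aff x y) -> regular x -> regular y.
Proof.
move=> /= /eqP e [u hu]; apply: place_sqr_regular; rewrite e.
by eexists; apply: (placeD pl) hb; apply: (placeD pl) (placeX 3 hu) (placeM pl ha hu).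
Qed.

(** The equation gives [(y / x^2)^2 = x^-1 + a x^-3 + b x^-4], which vanishes wherever [x] has a
    pole. *)
Lemma pole_x x y : oc (Aff x y) -> ~ regular x \/ ~ regular y ->
  [/\ x != 0, ~ regular x, V x^-1 0 & V (y / x ^+ 2) 0].
Proof.
move=> o hxy; have nrx : ~ regular x.
  by case: hxy => // h h'; apply: h; apply: on_curve_regular_y o h'.
have nx : x != 0 by apply/eqP => x0; apply: nrx; rewrite x0; exists 0; apply: place0.
have hx := nonregular_inv nrx.
have h0 : V ((y / x ^+ 2) ^+ 2) 0.
  have := placeD pl (placeD pl hx (placeM pl ha (placeX 3 hx))) (placeM pl hb (placeX 4 hx)).
  rewrite !expr0n !mulr0 !addr0; move/place_congr; apply => //.
  by move: o => /= /eqP o; rewrite expr_div_n o; field.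
split=> //; have [w hw] : regular (y / x ^+ 2) by apply: place_sqr_regular; exists 0.
have /eqP := place_uniq pl (placeX 2 hw) h0.
by rewrite sqrf_eq0 => /eqP w0; rewrite -w0.
Qed.

Lemma regular_dec f : regular f \/ ~ regular f.
Proof.
case: (place_total pl f) => [|hf]; first by left.
have [->|nf] := eqVneq f 0; first by left; exists 0; apply: place0.
right=> -[v hv]; have := placeM pl hv hf; rewrite mulfV // mulr0 => h.
by have /eqP := place_uniq pl h (place1 pl); rewrite eq_sym oner_eq0.
Qed.

Lemma red_on_curve R S : oc R -> red R S -> oc' S.
Proof.
case: R S => [|x y] [|u v] //= /eqP o [hx hy]; apply/eqP.
apply: (place_uniq pl (placeX 2 hy)); rewrite o.
by apply: (placeD pl) hb; apply: (placeD pl) (placeX 3 hx) (placeM pl ha hx).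
Qed.

Lemma red_uniq R S S' : red R S -> red R S' -> S = S'.
Proof.
case: R S S' => [|x y] [|u v] [|u' v'] //=.
- by move=> h [hx hy]; case: h => -[]; [exists u'|exists v'].
- by move=> [hx hy] h; case: h => -[]; [exists u|exists v].
by move=> [hx hy] [hx' hy']; rewrite (place_uniq pl hx hx') (place_uniq pl hy hy').
Qed.

Lemma red_negp R S : red R S -> red (negp R) (negp S).
Proof.
case: R S => [|x y] [|u v] //=; last by move=> [hx hy]; split=> //; apply: (placeN pl).
case; [by left|move=> h; right=> -[v hv]; apply: h].
by exists (- v); rewrite -[y]opprK; apply: (placeN pl).
Qed.

Lemma red_third l x1 y1 x2 m u1 v1 u2 : V l m -> V x1 u1 -> V y1 v1 -> V x2 u2 ->
  red (third l x1 y1 x2) (third m u1 v1 u2).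
Proof.
move=> hl hx1 hy1 hx2; have hx3 := placeB (placeB (placeX 2 hl) hx1) hx2.
by split=> //; apply: placeB hy1; apply: (placeM pl hl); apply: placeB hx3.
Qed.

(** One of the two equations of [slope_rel] has a nonzero coefficient of the slope after reduction,
    hence also before, so both slopes are the corresponding quotients. *)
Lemma slope_place x1 y1 x2 y2 l u1 v1 u2 v2 :
  oc' (Aff u1 v1) -> oc' (Aff u2 v2) -> Aff u2 v2 <> negp (Aff u1 v1) ->
  V x1 u1 -> V y1 v1 -> V x2 u2 -> V y2 v2 ->
  slope_rel a x1 y1 x2 y2 l -> exists2 m, slope_rel a' u1 v1 u2 v2 m & V l m.
Proof.
move=> o1 o2 nopp hx1 hy1 hx2 hy2 [s1 s2].
have [m sm] := slope_exists o1 o2 nopp; exists m => //; case: sm => t1 t2.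
have [e|n] := eqVneq u2 u1; last first.
  have nz : u2 - u1 != 0 by rewrite subr_eq0.
  apply: (place_congr (placeMV (placeB hy2 hy1) (placeB hx2 hx1) nz)).
    by rewrite -s1 mulfK //; apply: place_neq0 (placeB hx2 hx1) nz.
  by rewrite -t1 mulfK.
have nz : v1 + v2 != 0.
  apply/eqP => v0; apply: nopp; rewrite e /=; congr Aff.
  by apply/eqP; rewrite -addr_eq0 addrC v0.
have hy := placeD pl hy1 hy2; have ny := place_neq0 hy nz.
have hq := placeD pl (placeD pl (placeD pl (placeX 2 hx1) (placeM pl hx1 hx2)) (placeX 2 hx2)) ha.
apply: (place_congr (placeMV hq hy nz)); first by rewrite -s2 mulfK.
by rewrite -t2 mulfK.
Qed.

Lemma pole_addp x y x2 y2 u2 : oc (Aff x y) -> oc (Aff x2 y2) ->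
  ~ regular x -> V x2 u2 -> regular y2 ->
  exists x3 y3, Aff x y +' Aff x2 y2 = Aff x3 y3 /\ regular x3.
Proof.
move=> o1 o2 nrx hx2 [v2 hy2].
have [nx _ hx hy] := pole_x o1 (or_introl nrx).
have n12 : x2 - x != 0.
  by apply/eqP => /subr0_eq e; apply: nrx; exists u2; rewrite -e.
have nopp : Aff x2 y2 <> negp (Aff x y) by case=> e; rewrite e subrr eqxx in n12.
have [l sl] := slope_exists o1 o2 nopp.
rewrite (addp_third o1 o2 nopp sl) /third.
do 2!eexists; split; first by [].
have h1 : V (1 - x2 * x^-1) 1.
  by apply: place_congr (placeB (place1 pl) (placeM pl hx2 hx)) _ _; rewrite ?mulr0 ?subr0.
have n1 := place_neq0 h1 (oner_neq0 _).
have hc1 := placeD pl (placeX 2 hx2) ha.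
have hc2 := placeD pl (placeM pl (place_nat 2) hb) (placeM pl ha hx2).
(* The abscissa of the sum is [((x x2 + a) (x + x2) + 2 b - 2 y y2) / (x - x2)^2]; numerator and
   denominator are divided by [x^2] to become regular. *)
have hnum := placeB (placeD pl (placeD pl hx2 (placeM pl hx hc1)) (placeM pl (placeX 2 hx) hc2))
               (placeM pl (placeM pl (place_nat 2) hy2) hy).
eexists; apply: place_congr (placeMV hnum (placeX 2 h1) _) _ (erefl _).
  by rewrite expr1n oner_neq0.
have -> : l = (y2 - y) / (x2 - x) by case: sl => <- _; rewrite mulfK.
move: o1 o2 => /= /eqP o1 /eqP o2.
have -> : ((y2 - y) / (x2 - x)) ^+ 2 - x - x2 =
   (y2 ^+ 2 + y ^+ 2 - 2%:R * y * y2) / (x2 - x) ^+ 2 - x - x2 by field.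
rewrite o1 o2; field; rewrite nx n12 /=.
by move: n1; rewrite -(mulrI_eq0 _ (mulfI nx)); congr (_ != _); field.
Qed.

(** If the reductions are not opposite, slopes reduce to slopes. If they are, the sum is [Inf] or
    has a pole: a regular abscissa makes the slope [l] regular, and [l (x2 - x) = y2 - y] would
    reduce to 0 instead of [-2 v]. *)
Lemma red_addp_affine x y u v x2 y2 u2 v2 : oc (Aff x y) -> oc (Aff x2 y2) ->
  V x u -> V y v -> V x2 u2 -> V y2 v2 ->
  red (Aff x y +' Aff x2 y2) (addp a' (Aff u v) (Aff u2 v2)).
Proof.
move=> o1 o2 hx hy hx2 hy2.
have o1' : oc' (Aff u v) by apply: red_on_curve o1 _.
have o2' : oc' (Aff u2 v2) by apply: red_on_curve o2 _.
have [[e1 e2]|nopp'] := point_dec (Aff u2 v2) (negp (Aff u v)); last first.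
  have nopp : Aff x2 y2 <> negp (Aff x y).
    case=> e1 e2; apply: nopp' => /=; rewrite e1 in hx2; rewrite e2 in hy2.
    by rewrite (place_uniq pl hx hx2) (place_uniq pl (placeN pl hy) hy2).
  have [l sl] := slope_exists o1 o2 nopp.
  have [m sm hl] := slope_place o1' o2' nopp' hx hy hx2 hy2 sl.
  rewrite (addp_third o1 o2 nopp sl) (addp_third o1' o2' nopp' sm).
  exact: red_third.
rewrite e1 e2 addp_opp; rewrite e1 in hx2; rewrite e2 in hy2.
have nv : v + v != 0.
  by rewrite -mulr2n -mulr_natl mulf_neq0 ?nt'.1 // (on_curve_y_neq0 nt'.2 o1').
have [e|nx] := eqVneq x2 x.
  have : (y2 - y) * (y2 + y) == 0.
    have -> : (y2 - y) * (y2 + y) = y2 ^+ 2 - y ^+ 2 by ring.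
    by move: o1 o2 => /= /eqP -> /eqP ->; rewrite e subrr.
  rewrite mulf_eq0 => /orP[|].
    rewrite subr_eq0 => /eqP ey; case/eqP: nv; rewrite ey in hy2.
    by rewrite {1}(place_uniq pl hy hy2) addNr.
  by rewrite addr_eq0 => /eqP ->; rewrite e addp_opp.
have n12 : x2 - x != 0 by rewrite subr_eq0.
have nopp : Aff x2 y2 <> negp (Aff x y) by case=> e; rewrite e eqxx in nx.
have [l sl] := slope_exists o1 o2 nopp.
rewrite (addp_third o1 o2 nopp sl); left=> -[w hw].
have [m hm] : regular l.
  apply: place_sqr_regular; exists (w + u + u).
  by apply: place_congr (placeD pl (placeD pl hw hx) hx2) _ _; [ring|].
have := placeM pl hm (placeB hx2 hx); case: sl => -> _; rewrite subrr mulr0 => h0.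
case/eqP: nv; have := place_uniq pl h0 (placeB hy2 hy).
by move/eqP; rewrite eq_sym -opprD oppr_eq0 => /eqP.
Qed.

(** When [R] reduces to [Inf], its sum [R'] with the affine point [A] is regular. The affine case
    for [R' - A = R] shows that [R'] and [A] have the same reduction. *)
Lemma red_addp R S x2 y2 u2 v2 : oc R -> oc (Aff x2 y2) -> red R S ->
  V x2 u2 -> V y2 v2 -> red (R +' Aff x2 y2) (addp a' S (Aff u2 v2)).
Proof.
move=> oR oA hR hx2 hy2; case: R S oR hR => [|x y] [|u v] oR hR //; last first.
  by case: hR => hx hy; exact: red_addp_affine.
have [_ nrx _ _] := pole_x oR hR.
have [x3 [y3 [e hx3]]] := pole_addp oR oA nrx hx2 (ex_intro _ v2 hy2).
have o3 : oc (Aff x3 y3) by rewrite -e; apply: on_curve_addp.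
have [v3 hy3] := on_curve_regular_y o3 hx3; case: hx3 => u3 hx3.
have o3' : oc' (Aff u3 v3) by apply: red_on_curve o3 _.
have oA' : oc' (Aff u2 v2) by apply: red_on_curve oA _.
have hm := red_addp_affine o3 (on_curve_negp oA) hx3 hy3 hx2 (placeN pl hy2).
rewrite -/(negp (Aff x2 y2)) -/(negp (Aff u2 v2)) -e (addpK nt.1 nt.2 oR oA) in hm.
have h := addpK nt'.1 nt'.2 o3' (on_curve_negp oA').
rewrite (red_uniq hm hR) negpK in h.
by rewrite e [addp a' _ _]h.
Qed.
End Place.

Section RedGroup.
Variables (K k : fieldType) (V : K -> k -> Prop) (pl : is_place V).
Variables (a b : K) (a' b' : k) (ha : V a a') (hb : V b b').
Variables (nt : no_two_torsion a b) (nt' : no_two_torsion a' b').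
Implicit Types (R A : ecurve nt) (S T : ecurve nt').

Lemma red_add R A S T : red V (val R) (val S) -> red V (val A) (val T) -> T != 0 ->
  red V (val (R + A)) (val (S + T)).
Proof.
move=> hR; case: A T => [[|x y] oA] [[|u v] oT] //= hA nT.
by case: hA => hx hy; apply: (red_addp pl ha hb nt' (valP R) oA hR).
Qed.

Lemma red_opp R S : red V (val R) (val S) -> red V (val (- R)) (val (- S)).
Proof. exact: red_negp. Qed.

(** [A] is added one copy at a time to the accumulator [R], so the partial sums may reduce to [Inf]
    although [T] may not. *)
Lemma red_addMz R A S T (n : int) : red V (val R) (val S) -> red V (val A) (val T) ->
  T != 0 -> red V (val (R + A *~ n)) (val (S + T *~ n)).
Proof.
move=> hR hA nT; have nat_case A' T' m : red V (val A') (val T') -> T' != 0 ->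
    red V (val (R + A' *+ m)) (val (S + T' *+ m)).
  move=> hA' nT'; elim: m => [|m IH]; first by rewrite !addr0.
  by rewrite !mulrSr !addrA; apply: red_add.
case: n => n; first exact: nat_case.
rewrite NegzE !mulrNz -!mulNrz; apply: nat_case; first exact: red_opp.
by rewrite oppr_eq0.
Qed.
End RedGroup.

(** * The place of the rational function field at a rational number *)

Lemma fraction_div (f : Qt) : exists p q : {poly rat}, q != 0 /\ f = polyF p / polyF q.
Proof.
elim/quotW: f => r; exists (frac r).1, (frac r).2; split; first exact: denom_ratioP.
rewrite /polyF; unlock FracField.tofrac; rewrite -[X in _ = _ * X]FracField.pi_inv -[RHS]FracField.pi_mul.
apply/eqmodP => /=; rewrite FracField.equivfE /FracField.mulf /FracField.invf.
by rewrite !numden_Ratio ?mulr1 ?mul1r ?oner_neq0 ?denom_ratioP // mulrC.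
Qed.

HB.instance Definition _ := GRing.RMorphism.copy polyF (@FracField.tofrac {poly rat}).

Lemma polyF_eq0 p : (polyF p == 0) = (p == 0).
Proof. exact: tofrac_eq0. Qed.

Section RegularPlace.
Variable t0 : rat.

Lemma polyF_horner_neq0 (q : {poly rat}) : q.[t0] != 0 -> polyF q != 0.
Proof. by rewrite polyF_eq0; apply: contraNneq => ->; rewrite horner0. Qed.

Lemma regular_polyF p : regular_value t0 (polyF p) p.[t0].
Proof.
by exists p, 1; rewrite hornerC oner_neq0 rmorph1 !divr1.
Qed.

Lemma regular_value_place : is_place (regular_value t0).
Proof.
split.
- by have := regular_polyF 1; rewrite rmorph1 hornerC.
- move=> f v [p [q [nq [-> ->]]]]; exists (- p), q.
  by rewrite rmorphN hornerN !mulNr.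
- move=> f g v w [p [q [nq [-> ->]]]] [r [s [ns [-> ->]]]]; exists (p * s + r * q), (q * s).
  rewrite !hornerE mulf_neq0 // rmorphD !rmorphM; split=> //.
  by rewrite !addf_div // polyF_horner_neq0.
- move=> f g v w [p [q [nq [-> ->]]]] [r [s [ns [-> ->]]]]; exists (p * r), (q * s).
  by rewrite !hornerM mulf_neq0 // !rmorphM !mulf_div.
- move=> f v w [p [q [nq [-> ->]]]] [r [s [ns [e ->]]]].
  apply/eqP; rewrite eqr_div //; move/eqP: e; rewrite eqr_div ?polyF_horner_neq0 //.
  rewrite -!rmorphM -subr_eq0 -rmorphB polyF_eq0 subr_eq0 => /eqP e.
  by rewrite -!hornerM e.
move=> f; have [p [q [nq ->]]] := fraction_div f.
(* In lowest terms, numerator and denominator do not both vanish at [t0]. *)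
have ng : gcdp p q != 0 by rewrite gcdp_eq0 (negPf nq) andbF.
have cop : coprimep (p %/ gcdp p q) (q %/ gcdp p q) by rewrite coprimep_div_gcd ?nq ?orbT.
rewrite -[in polyF p](divpK (dvdp_gcdl p q)) -[in polyF q](divpK (dvdp_gcdr p q)).
rewrite !rmorphM -mulf_div divff ?polyF_eq0 // mulr1 invf_div.
have [e|ne] := eqVneq (q %/ gcdp p q).[t0] 0; last first.
  by left; exists ((p %/ gcdp p q).[t0] / (q %/ gcdp p q).[t0]), (p %/ gcdp p q), (q %/ gcdp p q).
right; exists (q %/ gcdp p q), (p %/ gcdp p q); rewrite e mul0r; split=> //.
rewrite coprimep_sym in cop.
by apply: (coprimep_root cop); rewrite rootE e.
Qed.
End RegularPlace.

(** * Local solubility of the 2-coverings *)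

Section LocalTests.
Local Open Scope Z_scope.
Implicit Types (m : nat) (X w s d e : Z).

Definition zrange m : seq Z := map Z.of_nat (iota 0 m).
Definition zmem (x : Z) (l : seq Z) : bool := has (Z.eqb x) l.
Definition is_sq (n : Z) : bool := Z.eqb (Z.sqrt n * Z.sqrt n) n.

Definition sq_class m d : seq Z :=
  map (fun s => (d * (s * s)) mod Z.of_nat m) (zrange m).

(** Solubility modulo [m] of the 2-covering [X - e_i w^2 = d_i s_i^2], with [w] taken from [ws]. *)
Definition locally_soluble (good : Z -> Z -> bool) (ws : seq Z) m (e1 e2 e3 d1 d2 d3 : Z) : bool :=
  let r := zrange m in
  let l1 := sq_class m d1 in let l2 := sq_class m d2 in let l3 := sq_class m d3 in
  has (fun w => has (fun X => [&& good X w,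
     zmem ((X - e1 * (w * w)) mod Z.of_nat m) l1,
     zmem ((X - e2 * (w * w)) mod Z.of_nat m) l2
   & zmem ((X - e3 * (w * w)) mod Z.of_nat m) l3]) r) ws.

(* Up to scaling by a unit, [w] may be taken to be [1] or divisible by [p], and
   only [w^2] matters. *)
Definition representatives (p : Z) m (ws : seq Z) : bool :=
  all (fun w => has (fun v => Z.eqb ((w * v) mod Z.of_nat m) 1) (zrange m)
    || Z.eqb (w mod p) 0 && has (fun w' => Z.eqb (w' mod p) 0
         && Z.eqb ((w' * w') mod Z.of_nat m) ((w * w) mod Z.of_nat m)) ws) (zrange m).

Definition prim (p X w : Z) : bool := ~~ (Z.eqb (X mod p) 0 && Z.eqb (w mod p) 0).

(** The real obstruction: [e < e'] makes [x - e] at least [x - e'], so a positive [d'] forces a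
    positive [d]. *)
Definition sign_ok (e e' d d' : Z) : bool := Z.ltb e e' && Z.ltb 0 d' ==> Z.ltb 0 d.

(* The classes of the three 2-torsion points: translation by [(e1, 0)] maps
   [x - e1] to [(e1 - e2) (e1 - e3) / (x - e1)], [x - e2] to
   [(e1 - e2) (x - e3) / (x - e1)] and [x - e3] to [(e1 - e3) (x - e2) / (x - e1)]. *)
Definition torsion_class (e1 e2 e3 d1 d2 d3 : Z) : bool :=
  is_sq ((e1 - e2) * (e1 - e3) * d1) && is_sq ((e1 - e2) * (d1 * d3))
    && is_sq ((e1 - e3) * (d1 * d2)).

Definition image_class (e1 e2 e3 d1 d2 d3 : Z) : bool :=
  [|| [&& is_sq d1, is_sq d2 & is_sq d3], torsion_class e1 e2 e3 d1 d2 d3,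
      torsion_class e2 e3 e1 d2 d3 d1 | torsion_class e3 e1 e2 d3 d1 d2].

(** The differences of the roots of the three cubics have no prime factors other than 2, 3, 5 and
    7. *)
Definition smooth_sqfree : seq Z :=
  [:: 1; 2; 3; 5; 6; 7; 10; 14; 15; 21; 30; 35; 42; 70; 105; 210].

Definition sqfree_divisors (c : Z) : seq Z :=
  filter (fun d => Z.eqb (c mod d) 0) (smooth_sqfree ++ map Z.opp smooth_sqfree).

(* The nested [if]s make the evaluation stop at the first failing test. *)
Definition selmer_trivial (e1 e2 e3 : Z) : bool :=
  all (fun d1 => all (fun d2 => all (fun d3 =>
    if ~~ [&& sign_ok e1 e2 d1 d2, sign_ok e1 e3 d1 d3, sign_ok e2 e1 d2 d1,
              sign_ok e2 e3 d2 d3, sign_ok e3 e1 d3 d1 & sign_ok e3 e2 d3 d2] then true else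
    if ~~ is_sq (d1 * d2 * d3) then true else
    if image_class e1 e2 e3 d1 d2 d3 then true else
    if ~~ locally_soluble (prim 3) [:: 1; 0] 9 e1 e2 e3 d1 d2 d3 then true else
    if ~~ locally_soluble (prim 5) [:: 1; 0] 25 e1 e2 e3 d1 d2 d3 then true else
    if ~~ locally_soluble (prim 2) [:: 1; 0; 2] 16 e1 e2 e3 d1 d2 d3 then true else
    ~~ locally_soluble (prim 7) [:: 1; 0] 49 e1 e2 e3 d1 d2 d3)
  (sqfree_divisors ((e3 - e1) * (e3 - e2)))) (sqfree_divisors ((e2 - e3) * (e2 - e1))))
  (sqfree_divisors ((e1 - e2) * (e1 - e3))).

(** The covering of the trivial class, whose points come from doubles, has no solution modulo 16
    with [w] odd. *)
Definition kernel_even (e1 e2 e3 : Z) : bool :=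
  ~~ locally_soluble (fun _ w => Z.eqb (w mod 2) 1) (zrange 16) 16 e1 e2 e3 1 1 1.

Lemma zmemP x (l : seq Z) : reflect (x \in l) (zmem x l).
Proof.
apply: (iffP hasP) => [[y yl /Z.eqb_eq ->] //|xl].
by exists x => //; apply/Z.eqb_eq.
Qed.

Lemma zrange_mod m X : (0 < m)%nat -> X mod Z.of_nat m \in zrange m.
Proof.
move=> m0; have [r0 rm] : 0 <= X mod Z.of_nat m < Z.of_nat m.
  by apply: Z.mod_pos_bound; lia.
apply/mapP; exists (Z.to_nat (X mod Z.of_nat m)); last by rewrite Z2Nat.id.
rewrite mem_iota leq0n add0n /=; apply/ssrnat.ltP; apply/Nat2Z.inj_lt.
by rewrite Z2Nat.id.
Qed.

Lemma sq_class_mod m d s : (0 < m)%nat -> zmem ((d * (s * s)) mod Z.of_nat m) (sq_class m d).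
Proof.
move=> m0; apply/zmemP/mapP; exists (s mod Z.of_nat m); first exact: zrange_mod.
by rewrite -Zmult_mod_idemp_r (Zmult_mod s s) Zmult_mod_idemp_r.
Qed.

Lemma locally_solubleP (good : Z -> Z -> bool) ws m w' (e1 e2 e3 d1 d2 d3 X w s1 s2 s3 : Z) :
  (0 < m)%nat -> X - e1 * (w * w) = d1 * (s1 * s1) -> X - e2 * (w * w) = d2 * (s2 * s2) ->
  X - e3 * (w * w) = d3 * (s3 * s3) ->
  w' \in ws -> (w' * w') mod Z.of_nat m = (w * w) mod Z.of_nat m ->
  good (X mod Z.of_nat m) w' -> locally_soluble good ws m e1 e2 e3 d1 d2 d3.
Proof.
move=> m0 h1 h2 h3 iw' ew g; set M := Z.of_nat m in g ew.
have red e : (X mod M - e * (w' * w')) mod M = (X - e * (w * w)) mod M.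
  rewrite Zminus_mod Zmod_mod -(Zmult_mod_idemp_r (w' * w')) ew.
  by rewrite Zmult_mod_idemp_r -Zminus_mod.
apply/hasP; exists w' => //; apply/hasP; exists (X mod M); first exact: zrange_mod.
by rewrite g !red h1 h2 h3 !sq_class_mod.
Qed.

Lemma prim_soluble (p m : nat) ws (e1 e2 e3 d1 d2 d3 X w s1 s2 s3 u v : Z) :
  (1 < p)%nat -> (1 < m)%nat -> (p %| m)%nat -> representatives (Z.of_nat p) m ws -> 1 \in ws ->
  X - e1 * (w * w) = d1 * (s1 * s1) -> X - e2 * (w * w) = d2 * (s2 * s2) ->
  X - e3 * (w * w) = d3 * (s3 * s3) -> u * X + v * w = 1 ->
  locally_soluble (prim (Z.of_nat p)) ws m e1 e2 e3 d1 d2 d3.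
Proof.
move=> p1 m1 /dvdnP[k mk] /allP reps one h1 h2 h3 bez.
have pm : (Z.of_nat p | Z.of_nat m) by exists (Z.of_nat k); rewrite mk; lia.
have p0 : 0 < Z.of_nat p by lia.
have m0 : 0 < Z.of_nat m by lia.
have /orP[/hasP[z _ /Z.eqb_eq ez]|/andP[/Z.eqb_eq pw /hasP[w' iw' /andP[/Z.eqb_eq pw' /Z.eqb_eq ew]]]] :=
  reps _ (zrange_mod w (ltnW m1)).
  (* Multiplying the solution by an inverse [z] of [w] modulo [m] normalizes [w] to 1. *)
  have scale e d s : X - e * (w * w) = d * (s * s) ->
    X * (z * z) - e * ((w * z) * (w * z)) = d * ((s * z) * (s * z)).
    by move=> h; transitivity ((X - e * (w * w)) * (z * z)); [ring|rewrite h; ring].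
  apply: (locally_solubleP _ (scale _ _ _ h1) (scale _ _ _ h2) (scale _ _ _ h3) one).
  - by lia.
  - by rewrite [in RHS]Zmult_mod -(Zmult_mod_idemp_l w) ez.
  - by rewrite /prim (Zmod_small 1) ?andbF //; lia.
apply: (locally_solubleP _ h1 h2 h3 iw'); first by lia.
  by rewrite ew -Zmult_mod.
apply/negP => /andP[/Z.eqb_eq hX _].
rewrite -Znumtheory.Zmod_div_mod // in hX; rewrite -Znumtheory.Zmod_div_mod // in pw.
have /Z.divide_1_r : (Z.of_nat p | 1); last by lia.
rewrite -bez; apply: Z.divide_add_r; apply: Z.divide_mul_r; apply: Znumtheory.Zmod_divide => //; lia.
Qed.

Lemma sign_okP e e' d d' X w s s' : s <> 0 -> s' <> 0 ->
  X - e * (w * w) = d * (s * s) -> X - e' * (w * w) = d' * (s' * s') -> sign_ok e e' d d'.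
Proof.
move=> s0 s0' h h'; apply/implyP => /andP[/Z.ltb_lt he /Z.ltb_lt hd]; apply/Z.ltb_lt.
have sp : 0 < s' * s' by nia.
have wp : 0 <= w * w by nia.
have dp : 0 < d' * (s' * s') by nia.
have : 0 < d * (s * s) by nia.
by nia.
Qed.

Lemma is_sqP n : is_sq n -> exists r, n = r * r.
Proof. by move=> /Z.eqb_eq <-; exists (Z.sqrt n). Qed.

Lemma is_sq_sqr r : is_sq (r * r).
Proof. by apply/Z.eqb_eq; rewrite -(Z.abs_square r) Z.sqrt_square //; lia. Qed.

Lemma selmer_trivialP e1 e2 e3 d1 d2 d3 X w s1 s2 s3 u v q : selmer_trivial e1 e2 e3 ->
  d1 \in sqfree_divisors ((e1 - e2) * (e1 - e3)) ->
  d2 \in sqfree_divisors ((e2 - e3) * (e2 - e1)) ->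
  d3 \in sqfree_divisors ((e3 - e1) * (e3 - e2)) ->
  X - e1 * (w * w) = d1 * (s1 * s1) -> X - e2 * (w * w) = d2 * (s2 * s2) ->
  X - e3 * (w * w) = d3 * (s3 * s3) -> s1 <> 0 -> s2 <> 0 -> s3 <> 0 ->
  u * X + v * w = 1 -> d1 * d2 * d3 = q * q -> image_class e1 e2 e3 d1 d2 d3.
Proof.
move=> /allP sel i1 i2 i3 h1 h2 h3 n1 n2 n3 bez hq.
have {sel} /allP sel := sel _ i1; have {sel} /allP sel := sel _ i2.
have {sel} := sel _ i3.
rewrite hq is_sq_sqr (sign_okP n1 n2 h1 h2) (sign_okP n1 n3 h1 h3) (sign_okP n2 n1 h2 h1).
rewrite (sign_okP n2 n3 h2 h3) (sign_okP n3 n1 h3 h1) (sign_okP n3 n2 h3 h2).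
case: ifP => // _.
by rewrite (@prim_soluble 3 _ _ _ _ _ _ _ _ _ _ _ _ _ _ _ _ _ _ _ _ h1 h2 h3 bez) //
  (@prim_soluble 5 _ _ _ _ _ _ _ _ _ _ _ _ _ _ _ _ _ _ _ _ h1 h2 h3 bez) //
  (@prim_soluble 2 _ _ _ _ _ _ _ _ _ _ _ _ _ _ _ _ _ _ _ _ h1 h2 h3 bez) //
  (@prim_soluble 7 _ _ _ _ _ _ _ _ _ _ _ _ _ _ _ _ _ _ _ _ h1 h2 h3 bez).
Qed.

Lemma kernel_evenP e1 e2 e3 X w s1 s2 s3 : kernel_even e1 e2 e3 ->
  X - e1 * (w * w) = s1 * s1 -> X - e2 * (w * w) = s2 * s2 -> X - e3 * (w * w) = s3 * s3 ->
  w mod 2 = 0.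
Proof.
move=> /negP ker h1 h2 h3; have [//|ho] : w mod 2 = 0 \/ w mod 2 = 1.
  by have := Z.mod_pos_bound w 2 (erefl _ : 0 < 2); lia.
case: ker; apply: (@locally_solubleP _ _ _ (w mod 16) _ _ _ _ _ _ X w s1 s2 s3);
  rewrite ?Z.mul_1_l //; first exact: (@zrange_mod 16).
  by rewrite -Zmult_mod.
by apply/Z.eqb_eq; rewrite -Znumtheory.Zmod_div_mod //; exists 8.
Qed.
End LocalTests.

(** * Descent on a cubic with integer roots *)

Lemma intq_inj (m n : int) : m%:~R = n%:~R :> rat -> m = n.
Proof. exact: intr_inj. Qed.

Lemma rat_sqr_int (r : rat) (z : int) : r ^+ 2 = z%:~R -> exists n : int, r = n%:~R.
Proof.
move=> e; exists (numq r); have nd := denq_neq0 r.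
have h : (denq r ^+ 2 %| numq r ^+ 2)%Z.
  apply/dvdzP; exists z; apply: intq_inj.
  by rewrite intrM !rmorphXn /= -e numqE exprMn.
rewrite dvdz_pexp2r // in h.
have /eqP d1 : denq r == 1.
  have := coprime_num_den r; rewrite -coprimezE /coprimez => /eqP c.
  have : (denq r %| gcdz (numq r) (denq r))%Z by rewrite dvdz_gcd h dvdzz.
  by rewrite c dvdz1 => /eqP e1; rewrite -absz_denq e1.
by rewrite -{1}[r]divq_num_den d1 divr1.
Qed.

(* The squarefree part of [a] may be replaced by a common divisor of [a] and [b]. *)
Lemma square_factor (a b n : int) : a != 0 -> a * b = n ^+ 2 ->
  exists d s : int, [/\ a = d * s ^+ 2, (d %| a)%Z & (d %| b)%Z].
Proof.
move=> a0 e; pose g := gcdz a n.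
have g0 : g != 0 by rewrite gcdz_eq0 (negPf a0).
have /dvdzP[a' ea] : (g %| a)%Z := dvdz_gcdl a n.
have /dvdzP[n' en] : (g %| n)%Z := dvdz_gcdr a n.
have a'0 : a' != 0 by apply: contraNneq a0 => h; rewrite ea h mul0r.
have cop : coprimez a' n'.
  apply/coprimezP; have [u [v euv]] := Bezoutz a n; exists (u, v) => /=.
  apply: (mulIf g0); rewrite mul1r mulrDl -!mulrA -ea -en euv //.
have e' : a' * b = g * n' ^+ 2.
  by apply: (mulIf g0); rewrite -mulrA [b * g]mulrC mulrA -ea e en; ring.
(* [a'] divides [g n'^2] and is coprime to [n'], so it divides [g]; the quotient is the common
   factor sought. *)
have [d eg] : exists d, g = d * a'.
  apply/dvdzP; rewrite -(@Gauss_dvdzl _ _ (n' ^+ 2)) ?coprimezXr // -e'.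
  exact: dvdz_mulr.
have eb : b = d * n' ^+ 2 by apply: (mulfI a'0); rewrite e' eg; ring.
have ea' : a = d * a' ^+ 2 by rewrite ea eg; ring.
exists d, a'; split; rewrite ?eb ?ea' //; exact: dvdz_mulr.
Qed.

(** A finite check in place of factorization. The range just admits [t = 20], needed for the divisor
    400 that occurs for the third cubic. *)
Definition smooth_squares (c : nat) : bool :=
  all (fun g => has (fun d => has (fun t => Z.eqb (Z.of_nat g) (Z.mul d (Z.mul t t))) (zrange 21))
    smooth_sqfree) (divisors c).

Lemma smooth_squaresP (c g : int) : c != 0 -> smooth_squares (absz c) -> (g %| c)%Z ->
  exists d t : int, g = d * t ^+ 2 /\ Z_of_int d \in sqfree_divisors (Z_of_int c).
Proof.
move=> c0 /allP sm gc.
have /sm/hasP[d dL /hasP[t _ /Z.eqb_eq e]] : absz g \in divisors (absz c).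
  by rewrite -dvdn_divisors ?absz_gt0.
have [eps [e1 eg]] : exists eps : int, (eps = 1 \/ eps = -1) /\
    g = eps * int_of_Z d * int_of_Z t ^+ 2.
  rewrite expr2; have [g0|g0] := leP 0 g; first by exists 1; split; [left|move: e; clear -g0; lia].
  by exists (-1); split; [right|move: e; clear -g0; lia].
exists (eps * int_of_Z d), (int_of_Z t); split=> //; rewrite mem_filter; apply/andP; split.
  have /dvdzP[q ->] : (eps * int_of_Z d %| c)%Z by apply: dvdz_trans gc; rewrite eg dvdz_mulr.
  by apply/Z.eqb_eq; rewrite rmorphM /=; apply: Z_mod_mult.
have -> : Z_of_int (eps * int_of_Z d) = Z.mul (Z_of_int eps) d by rewrite rmorphM /= int_of_ZK.
rewrite mem_cat; case: e1 => ->; apply/orP; [left|right]; first by rewrite Z.mul_1_l.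
by apply/mapP; exists d => //; rewrite Z.opp_eq_mul_m1 Z.mul_comm.
Qed.

(** Modulo [d], [X] is [e w^2] and the product of the other two factors becomes
    [(e - f) (e - g) w^4], while [d] is coprime to [w]. *)
Lemma cover_divisor (X w e f g d : int) : coprimez X w -> (d %| X - e * w ^+ 2)%Z ->
  (d %| (X - f * w ^+ 2) * (X - g * w ^+ 2))%Z -> (d %| (e - f) * (e - g))%Z.
Proof.
move=> cXw dA dB; have cdw : coprimez d (w ^+ 4).
  apply: coprimezXr; rewrite coprimezE; apply: coprime_dvdl dA _; rewrite -coprimezE.
  rewrite coprimez_sym /coprimez -(gcdzMDl (e * w)).
  have -> : e * w * w + (X - e * w ^+ 2) = X by ring.
  by rewrite gcdzC.
rewrite -(Gauss_dvdzl _ cdw).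
have -> : (e - f) * (e - g) * w ^+ 4 = (X - f * w ^+ 2) * (X - g * w ^+ 2)
   - (X - e * w ^+ 2) * (X + e * w ^+ 2 - (f + g) * w ^+ 2) by ring.
by rewrite rpredB // dvdz_mulr.
Qed.

Lemma square_quotient (D S n : int) : S != 0 -> D * S ^+ 2 = n ^+ 2 -> exists q, D = q ^+ 2.
Proof.
move=> S0 e; have /dvdzP[q eq] : (S %| n)%Z.
  by rewrite -(@dvdz_pexp2r _ _ 2) // -e dvdz_mull.
have S20 : S ^+ 2 != 0 by rewrite expf_neq0.
by exists q; apply: (mulIf S20); rewrite e eq; ring.
Qed.

Lemma is_sq_int (n : int) : is_sq (Z_of_int n) -> exists q : int, n = q ^+ 2.
Proof.
move=> /is_sqP[r e]; exists (int_of_Z r); rewrite expr2.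
by apply: (can_inj Z_of_intK); rewrite e rmorphM /= int_of_ZK.
Qed.

(* The halves of a point with coordinates [x - e_i = r_i^2] are the points with
   [x' - e_1 = (r1 + r2) (r1 + r3)], up to the signs of the [r_i]. *)
Definition square_half (r1 r2 r3 : rat) : Prop :=
  exists p1 p2 p3, [/\ (r1 + r2) * (r1 + r3) = p1 ^+ 2, (r2 + r3) * (r2 + r1) = p2 ^+ 2
    & (r3 + r1) * (r3 + r2) = p3 ^+ 2].

Lemma square_half_rot r1 r2 r3 : square_half r1 r2 r3 -> square_half r2 r3 r1.
Proof. by case=> p1 [p2 [p3 [h1 h2 h3]]]; exists p2, p3, p1. Qed.

(** Changing the signs of [r2] and [r3] translates the half by [(e1, 0)], because [(r1 - r2) (r1 -
    r3) (r1 + r2) (r1 + r3) = (e1 - e2) (e1 - e3)]. If the half had the class of [(e1, 0)], its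
    translate has the trivial class. *)
Lemma torsion_half (e1 e2 e3 d1 d2 d3 : int) (r1 r2 r3 s1 s2 s3 : rat) :
  torsion_class (Z_of_int e1) (Z_of_int e2) (Z_of_int e3)
    (Z_of_int d1) (Z_of_int d2) (Z_of_int d3) ->
  (r1 + r2) * (r1 + r3) = d1%:~R * s1 ^+ 2 -> (r2 + r3) * (r2 + r1) = d2%:~R * s2 ^+ 2 ->
  (r3 + r1) * (r3 + r2) = d3%:~R * s3 ^+ 2 -> (r1 + r2) * (r1 + r3) != 0 ->
  r1 ^+ 2 - r2 ^+ 2 = e2%:~R - e1%:~R -> r1 ^+ 2 - r3 ^+ 2 = e3%:~R - e1%:~R ->
  square_half r1 (- r2) (- r3).
Proof.
have sqz (m : int) z : is_sq z -> z = Z_of_int m -> exists q : rat, m%:~R = q ^+ 2.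
  by move=> h e; rewrite e in h; have [q ->] := is_sq_int h; exists q%:~R; rewrite rmorphXn.
case/andP=> /andP[q1 q2] q3 h1 h2 h3 nz h12 h13.
have [{}q1 hq1] := sqz ((e1 - e2) * (e1 - e3) * d1) _ q1 ltac:(clear; lia).
have [{}q2 hq2] := sqz ((e1 - e2) * (d1 * d3)) _ q2 ltac:(clear; lia).
have [{}q3 hq3] := sqz ((e1 - e3) * (d1 * d2)) _ q3 ltac:(clear; lia).
rewrite !rmorphM !rmorphB /= in hq1 hq2 hq3.
have eE2 : e2%:~R = e1%:~R + r1 ^+ 2 - r2 ^+ 2 :> rat by rewrite -addrA h12 addrC subrK.
have eE3 : e3%:~R = e1%:~R + r1 ^+ 2 - r3 ^+ 2 :> rat by rewrite -addrA h13 addrC subrK.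
rewrite eE2 ?eE3 in hq1 hq2 hq3.
have := nz; rewrite h1 mulf_eq0 sqrf_eq0 negb_or => /andP[nd ns].
have key N Q : N * (d1%:~R * ((r1 + r2) * (r1 + r3))) = Q ^+ 2 -> N = (Q / (d1%:~R * s1)) ^+ 2.
  by rewrite expr_div_n => <-; rewrite h1; field; rewrite nd ns.
exists (q1 / (d1%:~R * s1)), (q2 * s3 / (d1%:~R * s1)), (q3 * s2 / (d1%:~R * s1)).
split; apply: key.
- by rewrite -hq1; ring.
- transitivity (q2 ^+ 2 * s3 ^+ 2); last by ring.
  transitivity ((r2 ^+ 2 - r1 ^+ 2) * d1%:~R * ((r3 + r1) * (r3 + r2))); first by ring.
  by rewrite -hq2 h3; ring.
transitivity (q3 ^+ 2 * s2 ^+ 2); last by ring.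
transitivity ((r3 ^+ 2 - r1 ^+ 2) * d1%:~R * ((r2 + r3) * (r2 + r1))); first by ring.
by rewrite -hq3 h2; ring.
Qed.

Section Descent.
Variables e1 e2 e3 : int.
Implicit Types (x y : rat).
Hypotheses (n12 : e1 != e2) (n13 : e1 != e3) (n23 : e2 != e3).
Local Notation E1 := (e1%:~R : rat).
Local Notation E2 := (e2%:~R : rat).
Local Notation E3 := (e3%:~R : rat).

(* [x - e_i = d_i (s_i / w)^2] with [x = X / w^2] in lowest terms *)
Lemma two_cover (x y : rat) : y != 0 -> y ^+ 2 = (x - E1) * (x - E2) * (x - E3) ->
  exists X w : int, [/\ w != 0, coprimez X w, x = X%:~R / w%:~R ^+ 2
   & exists n, (X - e1 * w ^+ 2) * (X - e2 * w ^+ 2) * (X - e3 * w ^+ 2) = n ^+ 2].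
Proof.
move=> y0 e; pose X := numq x; pose W := denq x.
have W0 : W%:~R != 0 :> rat by rewrite intr_eq0 denq_neq0.
have ex : x = X%:~R / W%:~R by rewrite divq_num_den.
have cXW : coprimez X W by rewrite coprimezE coprime_num_den.
pose P := (X - e1 * W) * (X - e2 * W) * (X - e3 * W).
have eP : (y * W%:~R ^+ 2) ^+ 2 = (W * P)%:~R.
  by rewrite exprMn e ex /P !rmorphM !rmorphB /= !rmorphM /=; field.
have [n en] := rat_sqr_int eP.
have {en eP} eP : W * P = n ^+ 2.
  by apply: intq_inj; rewrite -eP en rmorphXn.
(* [W P] is a square with [W] and [P] coprime, so [d] is a unit; as [W > 0], [W] is a square. *)
have [d [s [eW dW dP]]] := square_factor (denq_neq0 x) eP.
have cWP : coprimez W P.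
  have c (z : int) : coprimez W (X - z * W).
    rewrite /coprimez -(gcdzMDl z) addrC subrK -/(coprimez _ _) coprimez_sym //.
  by rewrite !coprimezMr !c.
have d1 : (d %| gcdz W P)%Z by rewrite dvdz_gcd dW dP.
rewrite (eqP cWP : gcdz W P = 1) in d1.
have Wgt : 0 < W := denq_gt0 x.
rewrite -/W in eW.
have sW : W = s ^+ 2.
  have d_1 : d = 1 by move: d1 Wgt; rewrite eW dvdz1; nia.
  by rewrite eW d_1 mul1r.
have s0 : s != 0 by apply: contraTneq Wgt => s0; rewrite sW s0 expr0n ltxx.
exists X, s; split=> //.
- by apply: coprimez_dvdr cXW; rewrite sW -dvdzE dvdz_mulr.
- by rewrite ex sW rmorphXn.
move: eP; rewrite /P sW => eP; have [m em] : exists m, n = m * s.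
  by apply/dvdzP; rewrite -(@dvdz_pexp2r _ _ 2) // -eP dvdz_mulr.
exists m; have s20 : s ^+ 2 != 0 by rewrite expf_neq0.
by apply: (mulfI s20); rewrite eP em; ring.
Qed.

Hypotheses (sm1 : smooth_squares (absz ((e1 - e2) * (e1 - e3))))
           (sm2 : smooth_squares (absz ((e2 - e3) * (e2 - e1))))
           (sm3 : smooth_squares (absz ((e3 - e1) * (e3 - e2)))).
Hypothesis sel : selmer_trivial (Z_of_int e1) (Z_of_int e2) (Z_of_int e3).

(** [square_factor] leaves in each factor a divisor shared with the other two, [cover_divisor]
    bounds it by the differences of the roots, and the local tests of [sel] decide among the
    finitely many remaining classes. *)
Lemma cover_class x y : y != 0 -> y ^+ 2 = (x - E1) * (x - E2) * (x - E3) ->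
  exists (d1 d2 d3 : int) (s1 s2 s3 : rat),
  [/\ x - E1 = d1%:~R * s1 ^+ 2, x - E2 = d2%:~R * s2 ^+ 2, x - E3 = d3%:~R * s3 ^+ 2 &
    image_class (Z_of_int e1) (Z_of_int e2) (Z_of_int e3)
      (Z_of_int d1) (Z_of_int d2) (Z_of_int d3)].
Proof.
move=> y0 e; have [X [w [w0 cXw ex [n en]]]] := two_cover y0 e.
have w0' : w%:~R != 0 :> rat by rewrite intr_eq0.
have cf (z : int) : x - z%:~R = (X - z * w ^+ 2)%:~R / w%:~R ^+ 2.
  by rewrite ex rmorphB rmorphM rmorphXn /=; field.
have nz : (X - e1 * w ^+ 2) * (X - e2 * w ^+ 2) * (X - e3 * w ^+ 2) != 0.
  apply: contraNneq y0 => h; rewrite -sqrf_eq0 e !cf.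
  move/(congr1 (fun z : int => z%:~R : rat)): h; rewrite !rmorphM /= => h.
  apply/eqP; transitivity ((X - e1 * w ^+ 2)%:~R * (X - e2 * w ^+ 2)%:~R *
    (X - e3 * w ^+ 2)%:~R / w%:~R ^+ 6 : rat); first by field.
  by rewrite h mul0r.
have := nz; rewrite !mulf_eq0 !negb_or -andbA => /and3P[a10 a20 a30].
set a1 := X - e1 * w ^+ 2 in a10 en cf nz *.
set a2 := X - e2 * w ^+ 2 in a20 en nz *; set a3 := X - e3 * w ^+ 2 in a30 en nz *.
have [g1 [s1 [ea1 da1 db1]]] : exists d s, [/\ a1 = d * s ^+ 2, (d %| a1)%Z & (d %| a2 * a3)%Z].
  by apply: (@square_factor _ _ n) => //; rewrite -en; ring.
have [g2 [s2 [ea2 da2 db2]]] : exists d s, [/\ a2 = d * s ^+ 2, (d %| a2)%Z & (d %| a3 * a1)%Z].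
  by apply: (@square_factor _ _ n) => //; rewrite -en; ring.
have [g3 [s3 [ea3 da3 db3]]] : exists d s, [/\ a3 = d * s ^+ 2, (d %| a3)%Z & (d %| a1 * a2)%Z].
  by apply: (@square_factor _ _ n) => //; rewrite -en; ring.
have d0 (u v : int) : u != v -> u - v != 0 by rewrite subr_eq0.
have c1 : (e1 - e2) * (e1 - e3) != 0 by rewrite mulf_neq0 ?d0.
have c2 : (e2 - e3) * (e2 - e1) != 0 by rewrite mulf_neq0 ?d0 // eq_sym.
have c3 : (e3 - e1) * (e3 - e2) != 0 by rewrite mulf_neq0 ?d0 // eq_sym.
have [d1 [t1 [eg1 i1]]] := smooth_squaresP c1 sm1 (cover_divisor cXw da1 db1).
have [d2 [t2 [eg2 i2]]] := smooth_squaresP c2 sm2 (cover_divisor cXw da2 db2).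
have [d3 [t3 [eg3 i3]]] := smooth_squaresP c3 sm3 (cover_divisor cXw da3 db3).
have {}ea1 : a1 = d1 * (t1 * s1) ^+ 2 by rewrite ea1 eg1; ring.
have {}ea2 : a2 = d2 * (t2 * s2) ^+ 2 by rewrite ea2 eg2; ring.
have {}ea3 : a3 = d3 * (t3 * s3) ^+ 2 by rewrite ea3 eg3; ring.
move: (t1 * s1) (t2 * s2) (t3 * s3) ea1 ea2 ea3 => r1 r2 r3 ea1 ea2 ea3.
have rn d r (z : int) : z != 0 -> z = d * r ^+ 2 -> r != 0.
  by move=> z0 ez; apply: contraNneq z0 => r0; rewrite ez r0 expr0n mulr0.
have rn1 := rn _ _ _ a10 ea1; have rn2 := rn _ _ _ a20 ea2; have rn3 := rn _ _ _ a30 ea3.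
exists d1, d2, d3, (r1%:~R / w%:~R), (r2%:~R / w%:~R), (r3%:~R / w%:~R).
have sc (d r z : int) : X - z * w ^+ 2 = d * r ^+ 2 -> x - z%:~R = d%:~R * (r%:~R / w%:~R) ^+ 2.
  by move=> h; rewrite cf h rmorphM rmorphXn /=; field.
split; try exact: sc.
have [q eq] : exists q, d1 * d2 * d3 = q ^+ 2.
  apply: (@square_quotient _ (r1 * r2 * r3) n); first by rewrite !mulf_neq0.
  by rewrite -en ea1 ea2 ea3; ring.
have /coprimezP[[u v] /= bez] := cXw.
have eqZ (z d r : int) : X - z * w ^+ 2 = d * r ^+ 2 ->
  Z.sub (Z_of_int X) (Z.mul (Z_of_int z) (Z.mul (Z_of_int w) (Z_of_int w)))
    = Z.mul (Z_of_int d) (Z.mul (Z_of_int r) (Z_of_int r)).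
  by rewrite !expr2; clear; lia.
have neZ (r : int) : r != 0 -> Z_of_int r <> Z0 by clear; lia.
have bezZ : Z.add (Z.mul (Z_of_int u) (Z_of_int X)) (Z.mul (Z_of_int v) (Z_of_int w)) = Zpos xH
  by move: bez; clear; lia.
have qZ : Z.mul (Z.mul (Z_of_int d1) (Z_of_int d2)) (Z_of_int d3) = Z.mul (Z_of_int q) (Z_of_int q).
  by move: eq; rewrite expr2; clear; lia.
have prodZ (a b c : int) : Z_of_int ((a - b) * (a - c)) =
  Z.mul (Z.sub (Z_of_int a) (Z_of_int b)) (Z.sub (Z_of_int a) (Z_of_int c)) by clear; lia.
rewrite !prodZ in i1 i2 i3.
exact: (selmer_trivialP sel i1 i2 i3 (eqZ _ _ _ ea1) (eqZ _ _ _ ea2) (eqZ _ _ _ ea3)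
  (neZ _ rn1) (neZ _ rn2) (neZ _ rn3) bezZ qZ).
Qed.

(** The three numbers [E_i + r_i^2] coincide: they are the abscissa of a point all of whose
    differences with the roots are squares, that is, of a double. *)
Definition square_point (r1 r2 r3 : rat) : Prop :=
  r1 ^+ 2 - r2 ^+ 2 = E2 - E1 /\ r1 ^+ 2 - r3 ^+ 2 = E3 - E1.

(** The half with [x - E1 = (r1 + r2) (r1 + r3)] has the class of a point of order at most 2.
    Translating by that point, a change of two signs, yields a half that is itself a double. *)
Lemma square_point_half r1 r2 r3 : square_point r1 r2 r3 ->
  exists R1 R2 R3, [/\ R1 ^+ 2 = r1 ^+ 2, square_point R1 R2 R3 & square_half R1 R2 R3].
Proof.
move=> [h12 h13].
have s0 (z t : int) (r s : rat) : z != t -> r ^+ 2 - s ^+ 2 = t%:~R - z%:~R -> r + s != 0.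
  move=> nzt h; apply: contra_neq nzt => e; apply: intq_inj; apply/esym/eqP.
  by rewrite -subr_eq0 -h subr_sqr e mulr0.
have h23 : r2 ^+ 2 - r3 ^+ 2 = E3 - E2.
  have -> : r2 ^+ 2 - r3 ^+ 2 = (r1 ^+ 2 - r3 ^+ 2) - (r1 ^+ 2 - r2 ^+ 2) by ring.
  by rewrite h12 h13; ring.
have [n12' n13' n23'] : [/\ r1 + r2 != 0, r1 + r3 != 0 & r2 + r3 != 0].
  by split; [exact: s0 n12 h12|exact: s0 n13 h13|exact: s0 n23 h23].
have y0 : (r1 + r2) * (r1 + r3) * (r2 + r3) != 0 by rewrite !mulf_neq0.
have eE2 : E2 = E1 + r1 ^+ 2 - r2 ^+ 2 by rewrite -addrA h12 addrC subrK.
have eE3 : E3 = E1 + r1 ^+ 2 - r3 ^+ 2 by rewrite -addrA h13 addrC subrK.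
have ey : ((r1 + r2) * (r1 + r3) * (r2 + r3)) ^+ 2 =
  ((r1 + r2) * (r1 + r3) + E1 - E1) * ((r1 + r2) * (r1 + r3) + E1 - E2)
   * ((r1 + r2) * (r1 + r3) + E1 - E3) by rewrite eE2 eE3; ring.
have [d1 [d2 [d3 [s1 [s2 [s3 [c1 c2 c3 im]]]]]]] := cover_class y0 ey.
have {}c1 : (r1 + r2) * (r1 + r3) = d1%:~R * s1 ^+ 2 by rewrite -c1; ring.
have {}c2 : (r2 + r3) * (r2 + r1) = d2%:~R * s2 ^+ 2 by rewrite -c2 eE2; ring.
have {}c3 : (r3 + r1) * (r3 + r2) = d3%:~R * s3 ^+ 2 by rewrite -c3 eE3; ring.
case/or4P: im => [/and3P[q1 q2 q3]|T|T|T].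
- exists r1, r2, r3; split=> //; rewrite /square_half c1 c2 c3.
  have [{}q1 ->] := is_sq_int q1; have [{}q2 ->] := is_sq_int q2.
  have [{}q3 ->] := is_sq_int q3.
  exists (q1%:~R * s1), (q2%:~R * s2), (q3%:~R * s3).
  by rewrite !rmorphXn /= !exprMn.
- exists r1, (- r2), (- r3); rewrite /square_point !sqrrN; split=> //.
  by apply: (torsion_half T c1 c2 c3); rewrite // mulf_neq0.
- exists (- r1), r2, (- r3); rewrite /square_point !sqrrN; split=> //.
  do 2!apply: square_half_rot; apply: (torsion_half T c2 c3 c1) => //.
  + by rewrite mulf_neq0 // addrC.
  + by rewrite -opprB h12 opprB.
exists (- r1), (- r2), r3; rewrite /square_point !sqrrN; split=> //.
apply: square_half_rot; apply: (torsion_half T c3 c1 c2) => //.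
- by rewrite mulf_neq0 // addrC.
- by rewrite -opprB h13 opprB.
by rewrite -opprB h23 opprB.
Qed.

(** The equation is the duplication formula for [x - E1], equal to [p1^2] at the half and to [r1^2]
    at its double. *)
Lemma square_point_halve r1 r2 r3 : square_point r1 r2 r3 ->
  exists p1 p2 p3, square_point p1 p2 p3 /\
   4%:R * r1 ^+ 2 * p1 ^+ 2 * (p1 ^+ 2 + (E1 - E2)) * (p1 ^+ 2 + (E1 - E3))
   = (p1 ^+ 4 - (E1 - E2) * (E1 - E3)) ^+ 2.
Proof.
move=> /square_point_half[R1 [R2 [R3 [<- [h12 h13] [p1 [p2 [p3 [a1 a2 a3]]]]]]]].
exists p1, p2, p3; rewrite /square_point -a1 -a2 -a3 -h12 -h13.
split; first by split; ring.
have -> : p1 ^+ 4 = (p1 ^+ 2) ^+ 2 by ring.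
by rewrite -(opprB E2) -(opprB E3) -h12 -h13 -a1; ring.
Qed.

Hypothesis ev : kernel_even (Z_of_int e1) (Z_of_int e2) (Z_of_int e3).

(** With [p1 = a / W], each [p_i W] is a rational square root of an integer, hence an integer; so
    [X = a^2 + e1 W^2] and [w = W] solve the covering of the trivial class. *)
Lemma square_point_even p1 p2 p3 : square_point p1 p2 p3 -> (2 %| denq p1)%Z.
Proof.
move=> [h12 h13]; set a := numq p1; set W := denq p1.
have W0 : W%:~R != 0 :> rat by rewrite intr_eq0 denq_neq0.
have ep : p1 = a%:~R / W%:~R by rewrite divq_num_den.
have int_of (e : int) (p : rat) : p1 ^+ 2 - p ^+ 2 = e%:~R - E1 ->
    exists b : int, a ^+ 2 + e1 * W ^+ 2 - e * W ^+ 2 = b ^+ 2.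
  move=> h; have hp : p ^+ 2 = p1 ^+ 2 + E1 - e%:~R.
    by have -> : e%:~R = E1 + p1 ^+ 2 - p ^+ 2; [rewrite -addrA h addrC subrK|ring].
  have hW : (p * W%:~R) ^+ 2 = (a ^+ 2 + e1 * W ^+ 2 - e * W ^+ 2)%:~R.
    rewrite rmorphB rmorphD !rmorphM /= ?rmorphXn /= exprMn hp ep; field.
    exact: W0.
  have [b eb] := rat_sqr_int hW; exists b; apply: intq_inj.
  by rewrite -hW eb rmorphXn.
have [b1 hb1] := int_of e1 p1 ltac:(by rewrite !subrr).
have [b2 hb2] := int_of _ _ h12; have [b3 hb3] := int_of _ _ h13.
have toZ (X e w b : int) : X - e * w ^+ 2 = b ^+ 2 ->
  Z.sub (Z_of_int X) (Z.mul (Z_of_int e) (Z.mul (Z_of_int w) (Z_of_int w)))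
  = Z.mul (Z_of_int b) (Z_of_int b) by rewrite !expr2; clear; lia.
have := kernel_evenP ev (toZ _ _ _ _ hb1) (toZ _ _ _ _ hb2) (toZ _ _ _ _ hb3).
move=> /Znumtheory.Zmod_divide[//|k ek]; apply/dvdzP; exists (int_of_Z k).
by apply: (can_inj Z_of_intK); rewrite rmorphM /= int_of_ZK ek.
Qed.

(** The duplication formula over the integers shows that [4 W^2] divides [(a^4 - c W^4)^2 Z^2],
    where [W] and [Z] are the denominators of [p1] and [r1]. As [W] is even and [a] odd, the first
    square is odd, so every halving saves a factor 4. *)
Lemma square_point_pow4_dvd k r1 r2 r3 : square_point r1 r2 r3 -> (4 ^+ k %| denq r1 ^+ 2)%Z.
Proof.
elim: k r1 r2 r3 => [|k IH] r1 r2 r3 h; first by rewrite expr0 dvd1z.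
have [p1 [p2 [p3 [hp e]]]] := square_point_halve h.
have dW := IH _ _ _ hp; have evW := square_point_even hp.
move: dW evW e; set W := denq p1; set a := numq p1; set Z := denq r1; set u := numq r1.
have W0 : W%:~R != 0 :> rat by rewrite intr_eq0 denq_neq0.
have Z0 : Z%:~R != 0 :> rat by rewrite intr_eq0 denq_neq0.
have -> : p1 = a%:~R / W%:~R by rewrite divq_num_den.
have -> : r1 = u%:~R / Z%:~R by rewrite divq_num_den.
move=> dW evW e.
pose c := (e1 - e2) * (e1 - e3).
have eI : 4 * u ^+ 2 * a ^+ 2 * (a ^+ 2 + (e1 - e2) * W ^+ 2) * (a ^+ 2 + (e1 - e3) * W ^+ 2)
    * W ^+ 2 = (a ^+ 4 - c * W ^+ 4) ^+ 2 * Z ^+ 2.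
  apply: intq_inj; rewrite /c !(rmorphM, rmorphXn, rmorphD, rmorphB) /=.
  have := congr1 (fun t : rat => t * (Z%:~R ^+ 2 * W%:~R ^+ 8)) e.
  by move=> eq; etransitivity; [etransitivity; [|exact: eq]|]; field; rewrite ?Z0 W0.
have cop : coprimez (a ^+ 4 - c * W ^+ 4) W.
  rewrite coprimez_sym /coprimez -(gcdzMDl (c * W ^+ 3)).
  have -> : c * W ^+ 3 * W + (a ^+ 4 - c * W ^+ 4) = a ^+ 4 by ring.
  by apply: coprimezXr; rewrite coprimez_sym coprimezE coprime_num_den.
have cop2 : coprimez (4 ^+ k.+1) ((a ^+ 4 - c * W ^+ 4) ^+ 2).
  apply: coprimezXl; apply: coprimezXr; rewrite (_ : 4 = 2 ^+ 2) //; apply: coprimezXl.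
  by rewrite coprimezE; apply: coprime_dvdl evW _; rewrite -coprimezE coprimez_sym.
rewrite -(Gauss_dvdzr _ cop2) -eI [4 ^+ k.+1]exprS.
have -> : 4 * u ^+ 2 * a ^+ 2 * (a ^+ 2 + (e1 - e2) * W ^+ 2) * (a ^+ 2 + (e1 - e3) * W ^+ 2)
    * W ^+ 2 = (4 * W ^+ 2) * (u ^+ 2 * a ^+ 2 * (a ^+ 2 + (e1 - e2) * W ^+ 2)
      * (a ^+ 2 + (e1 - e3) * W ^+ 2)) by ring.
by apply: dvdz_mulr; apply: dvdz_mul.
Qed.

Lemma no_square_point r1 r2 r3 : ~ square_point r1 r2 r3.
Proof.
(* The exponent is the squared denominator [k] itself, since [4^k > k]. *)
move=> h; have := square_point_pow4_dvd (absz (denq r1 ^+ 2)) h.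
rewrite /dvdz => /dvdn_leq; rewrite absz_gt0 expf_neq0 ?denq_neq0 // => /(_ isT).
by rewrite abszX leqNgt ltn_expl.
Qed.

(* [r_i] is the square root of [x' - e_i], where [x'] is the abscissa of the
   double of [(x, y)]. *)
Lemma cubic_only_roots x y : y ^+ 2 = (x - E1) * (x - E2) * (x - E3) -> y = 0.
Proof.
move=> e; apply/eqP; apply/negPn/negP => y0.
have nz : (x - E1) * (x - E2) * (x - E3) != 0 by rewrite -e expf_neq0.
have := nz; rewrite !mulf_eq0 !negb_or -andbA => /and3P[z1 z2 z3].
pose r (a b c : rat) := ((x - a) ^+ 2 - (a - b) * (a - c)) / (2%:R * y).
have r2 a b c : r a b c ^+ 2 = ((x - a) ^+ 2 - (a - b) * (a - c)) ^+ 2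
    / (4%:R * ((x - E1) * (x - E2) * (x - E3))).
  by rewrite expr_div_n exprMn e -natrX.
apply: (@no_square_point (r E1 E2 E3) (r E2 E3 E1) (r E3 E1 E2)).
by rewrite /square_point !r2; split; field; rewrite z1 z2 z3.
Qed.
End Descent.

(** * The three quartics *)

Definition descent_succeeds (e1 e2 e3 : int) : bool :=
  [&& e1 != e2, e1 != e3, e2 != e3,
      smooth_squares (absz ((e1 - e2) * (e1 - e3))),
      smooth_squares (absz ((e2 - e3) * (e2 - e1))),
      smooth_squares (absz ((e3 - e1) * (e3 - e2))),
      selmer_trivial (Z_of_int e1) (Z_of_int e2) (Z_of_int e3)
    & kernel_even (Z_of_int e1) (Z_of_int e2) (Z_of_int e3)].

Lemma descent_cubic_only_roots (e1 e2 e3 : int) (x y : rat) : descent_succeeds e1 e2 e3 ->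
  y ^+ 2 = (x - e1%:~R) * (x - e2%:~R) * (x - e3%:~R) -> y = 0.
Proof. by case/and5P=> n12 n13 n23 sm1 /and4P[sm2 sm3 sel ev]; apply: cubic_only_roots. Qed.

Lemma quartic_P (l s : rat) : s ^+ 2 = 8 * l * (l - 2) * (l - 3) * (l - 7) -> s = 0.
Proof.
move=> e; have [l0|l0] := eqVneq l 0.
  by apply/eqP; rewrite -sqrf_eq0 e l0 mulr0 !mul0r.
have : 42 * s / l ^+ 2 = 0.
  (* The substitution sends the root 0 of the quartic to infinity and 3, 2, 7 to 0, -14, 16. *)
  apply: (@descent_cubic_only_roots 0 (-14) 16 (28 - 84 / l)); first by vm_compute.
  have -> : (42 * s / l ^+ 2) ^+ 2 = 1764 * s ^+ 2 / l ^+ 4 by field.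
  by rewrite e; field.
move=> h; have -> : s = 42 * s / l ^+ 2 * (l ^+ 2 / 42) by field.
by rewrite h mul0r.
Qed.

Lemma quartic_Q (l s : rat) : s ^+ 2 = - (l - 1) * (l - 3) * (l - 5) * (l + 9) -> s = 0.
Proof.
move=> e; have [l0|] := eqVneq l 1.
  by apply/eqP; rewrite -sqrf_eq0 e l0 subrr oppr0 !mul0r.
rewrite -subr_eq0 => l0; have : 10 * s / (l - 1) ^+ 2 = 0.
  (* Here 1 goes to infinity and 3, 5, -9 go to -10, -5, 2. *)
  apply: (@descent_cubic_only_roots (-10) (-5) 2 (- 20 / (l - 1))); first by vm_compute.
  have -> : (10 * s / (l - 1) ^+ 2) ^+ 2 = 100 * s ^+ 2 / (l - 1) ^+ 4 by field.
  by rewrite e; field.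
move=> h; have -> : s = 10 * s / (l - 1) ^+ 2 * ((l - 1) ^+ 2 / 10) by field.
by rewrite h mul0r.
Qed.

Lemma quartic_PQ (l s : rat) : s ^+ 2 = 8 * l * (l - 2) * (l + 3) * (l + 5) -> s = 0.
Proof.
move=> e; have [l0|l0] := eqVneq l 0.
  by apply/eqP; rewrite -sqrf_eq0 e l0 mulr0 !mul0r.
have : 30 * s / l ^+ 2 = 0.
  (* Here 0 goes to infinity and 2, -3, -5 go to -30, 20, 12. *)
  apply: (@descent_cubic_only_roots (-30) 20 12 (- 60 / l)); first by vm_compute.
  have -> : (30 * s / l ^+ 2) ^+ 2 = 900 * s ^+ 2 / l ^+ 4 by field.
  by rewrite e; field.
move=> h; have -> : s = 30 * s / l ^+ 2 * (l ^+ 2 / 30) by field.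
by rewrite h mul0r.
Qed.

(* [l] is minus the slope of the tangent at [A]. *)
Lemma double_slope (K : fieldType) (a b : K) (A : point K) (x y : K) :
  on_curve a b A -> addp a A A = Aff x y ->
  exists l, l ^+ 4 - 6%:R * x * l ^+ 2 + 8%:R * y * l - 3%:R * x ^+ 2 - 4%:R * a = 0.
Proof.
case: A => [//|x1 y1] oA eA; have [[e]|nopp] := point_dec (Aff x1 y1) (negp (Aff x1 y1)).
  by move: eA; rewrite {2}e addp_opp.
have [l sl] := slope_exists oA oA nopp.
move: eA; rewrite (addp_third oA oA nopp sl) => -[<- <-]; exists (- l).
case: sl => _ s2; have -> : a = l * (y1 + y1) - (x1 ^+ 2 + x1 * x1 + x1 ^+ 2) by rewrite s2; ring.
by ring.
Qed.

(** * Independence of the specialized points *)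

Definition excluded : seq rat := [:: -26; -19; -12; -11; -5; -3; -1; 6; 9; 44].

Lemma excluded_neq (t : rat) i : t \notin excluded -> (i < 10)%N -> t <> excluded`_i.
Proof. by move=> tE i10 e; move: tE; rewrite e => /negP; apply; apply: mem_nth. Qed.

Section Fibre.
Variable t : rat.
Hypothesis tE : t \notin excluded.
Let a := a0 t.
Let b := b0 t.

Lemma P_not_double (A : point rat) : on_curve a b A ->
  addp a A A <> Aff (t + 3) (4 * t + 6).
Proof.
move=> oA /(double_slope oA)[l e].
(* [e] is a monic quadratic in [t]. Completing the square makes the square of this expression equal
   to a quarter of the discriminant, the quartic of [quartic_P]. *)
have s0 : t - 3 * l ^+ 2 + 16 * l - 9 = 0.
  apply: (@quartic_P l); apply/eqP; rewrite -subr_eq0; apply/eqP.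
  by rewrite -[RHS]e /a /a0; ring.
have et : t = 3 * l ^+ 2 - 16 * l + 9.
  by rewrite -[LHS]subr0 -s0; ring.
have : l * (l - 2) * (l - 3) * (l - 7) = 0.
  by move: e; rewrite /a /a0 et => e; rewrite -[RHS](mul0r (-8)^-1) -e; field.
move/eqP; rewrite !mulf_eq0 !subr_eq0 -!orbA => /or4P[] /eqP el.
- by apply: (excluded_neq tE (isT : (8 < 10)%N)); change (t = 9); rewrite et el; ring.
- by apply: (excluded_neq tE (isT : (3 < 10)%N)); change (t = -11); rewrite et el; ring.
- by apply: (excluded_neq tE (isT : (2 < 10)%N)); change (t = -12); rewrite et el; ring.
- by apply: (excluded_neq tE (isT : (9 < 10)%N)); change (t = 44); rewrite et el; ring.
Qed.

Lemma Q_not_double (A : point rat) : on_curve a b A ->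
  addp a A A <> Aff 9 (t + 24).
Proof.
move=> oA /(double_slope oA)[l e].
(* The same completion; the quadratic now has leading coefficient 4. *)
have s0 : 2 * (t + l) = 0.
  apply: (@quartic_Q l); apply/eqP; rewrite -subr_eq0; apply/eqP.
  by rewrite -[RHS]e /a /a0; ring.
have et : t = - l.
  by have -> : t = 2 * (t + l) / 2 - l; [field|rewrite s0; ring].
have : (l - 1) * (l - 3) * (l - 5) * (l + 9) = 0.
  by move: e; rewrite /a /a0 et => e; rewrite -[RHS]e; ring.
move/eqP; rewrite !mulf_eq0 !subr_eq0 addr_eq0 -!orbA => /or4P[] /eqP el.
- by apply: (excluded_neq tE (isT : (6 < 10)%N)); change (t = -1); rewrite et el; ring.
- by apply: (excluded_neq tE (isT : (5 < 10)%N)); change (t = -3); rewrite et el; ring.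
- by apply: (excluded_neq tE (isT : (4 < 10)%N)); change (t = -5); rewrite et el; ring.
- by apply: (excluded_neq tE (isT : (8 < 10)%N)); change (t = 9); rewrite et el; ring.
Qed.

Lemma PQ_not_double (A : point rat) : on_curve a b A ->
  addp a A A <> Aff (- t - 3) (2 * t + 12).
Proof.
move=> oA /(double_slope oA)[l e].
have s0 : t + 3 * l ^+ 2 + 8 * l - 9 = 0.
  apply: (@quartic_PQ l); apply/eqP; rewrite -subr_eq0; apply/eqP.
  by rewrite -[RHS]e /a /a0; ring.
have et : t = - 3 * l ^+ 2 - 8 * l + 9.
  by rewrite -[LHS]subr0 -s0; ring.
have : l * (l - 2) * (l + 3) * (l + 5) = 0.
  by move: e; rewrite /a /a0 et => e; rewrite -[RHS](mul0r (-8)^-1) -e; field.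
move/eqP; rewrite !mulf_eq0 !subr_eq0 !addr_eq0 -!orbA => /or4P[] /eqP el.
- by apply: (excluded_neq tE (isT : (8 < 10)%N)); change (t = 9); rewrite et el; ring.
- by apply: (excluded_neq tE (isT : (1 < 10)%N)); change (t = -19); rewrite et el; ring.
- by apply: (excluded_neq tE (isT : (7 < 10)%N)); change (t = 6); rewrite et el; ring.
- by apply: (excluded_neq tE (isT : (0 < 10)%N)); change (t = -26); rewrite et el; ring.
Qed.
End Fibre.

(** * Reduction of the generators and injectivity *)

Section Specialization.
Variable t : rat.
Hypothesis tE : t \notin excluded.
Hypothesis no_root0 : forall r : rat, r ^+ 3 + a0 t * r + b0 t != 0.

Let nt' : no_two_torsion (a0 t) (b0 t).
Proof. by split=> //; rewrite pnatr_eq0. Qed.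
Let pl := regular_value_place t.

Lemma regular_aE : regular_value t (polyF aE) (a0 t).
Proof. by have := regular_polyF t aE; rewrite /aE /a0 !(hornerN, hornerD, hornerZ, hornerXn, hornerX, hornerC). Qed.
Lemma regular_bE : regular_value t (polyF bE) (b0 t).
Proof. by have := regular_polyF t bE; rewrite /bE /b0 !(hornerN, hornerD, hornerZ, hornerXn, hornerX, hornerC). Qed.

Let nt : no_two_torsion (polyF aE) (polyF bE) := place_root_free pl regular_aE regular_bE nt'.

Lemma on_curve_polyF (x y : {poly rat}) : y ^+ 2 = x ^+ 3 + aE * x + bE ->
  on_curve (polyF aE) (polyF bE) (Aff (polyF x) (polyF y)).
Proof. by move=> e; rewrite /= -!rmorphXn -rmorphM -!rmorphD e. Qed.

Lemma on_curve_PE : on_curve (polyF aE) (polyF bE) PE.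
Proof. by apply: on_curve_polyF; rewrite /aE /bE -!mul_polyC; ring. Qed.
Lemma on_curve_QE : on_curve (polyF aE) (polyF bE) QE.
Proof. by apply: on_curve_polyF; rewrite /aE /bE -!mul_polyC; ring. Qed.

Let oc0 := on_curve (a0 t) (b0 t).
Lemma on_curve_P0 : oc0 (Aff (t + 3) (4 * t + 6)).
Proof. by apply/eqP; rewrite /a0 /b0; ring. Qed.
Lemma on_curve_Q0 : oc0 (Aff 9 (t + 24)).
Proof. by apply/eqP; rewrite /a0 /b0; ring. Qed.

Let P : ecurve nt := Sub PE on_curve_PE.
Let Q : ecurve nt := Sub QE on_curve_QE.
Let P0 : ecurve nt' := Sub (Aff (t + 3) (4 * t + 6)) on_curve_P0.
Let Q0 : ecurve nt' := Sub (Aff 9 (t + 24)) on_curve_Q0.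

Lemma red_P : red (regular_value t) (val P) (val P0).
Proof.
split; first by have := regular_polyF t ('X + 3%:R%:P); rewrite !(hornerN, hornerD, hornerZ, hornerXn, hornerX, hornerC).
by have := regular_polyF t (4%:R *: 'X + 6%:R%:P); rewrite !(hornerN, hornerD, hornerZ, hornerXn, hornerX, hornerC).
Qed.
Lemma red_Q : red (regular_value t) (val Q) (val Q0).
Proof.
split; first by have := regular_polyF t 9%:R%:P; rewrite !(hornerN, hornerD, hornerZ, hornerXn, hornerX, hornerC).
by have := regular_polyF t ('X + 24%:R%:P); rewrite !(hornerN, hornerD, hornerZ, hornerXn, hornerX, hornerC).
Qed.

Lemma val_P0Q0 : val (P0 + Q0) = Aff (- t - 3) (2 * t + 12).
Proof.
have t6 : t != 6 by apply/eqP; exact: (excluded_neq tE (isT : (7 < 10)%N)).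
(* The chord has slope [(18 - 3 t) / (6 - t) = 3]; its end points have distinct abscissae as
   [t <> 6]. *)
rewrite val_ecD [val P0]/= [val Q0]/= (@addp_third _ _ _ _ _ _ _ 3 on_curve_P0 on_curve_Q0).
- by rewrite /third; congr Aff; ring.
- by case=> e _; case/eqP: t6; have -> : t = (t + 3) - 3 by [ring|]; rewrite -e; ring.
by split; rewrite /a0; ring.
Qed.

Lemma P0_Q0_free (n m : int) : P0 *~ n + Q0 *~ m = 0 -> n = 0 /\ m = 0.
Proof.
apply: free_of_not_double; first exact: ec_double_eq0.
- by move=> A /(congr1 val); rewrite mulr2n val_ecD; apply: (P_not_double tE); apply: valP.
- by move=> A /(congr1 val); rewrite mulr2n val_ecD; apply: (Q_not_double tE); apply: valP.
move=> A /(congr1 val); rewrite val_P0Q0 mulr2n val_ecD.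
by apply: (PQ_not_double tE); apply: valP.
Qed.

(** [spec] unfolds to [red] for the place at [t], so additivity follows from [red_addMz], started at
    0, and from the uniqueness of reductions. *)
Lemma spec_combination (n m : int) (S : point rat) :
  spec t (addp (polyF aE) (Defs.mulpz (polyF aE) n PE) (Defs.mulpz (polyF aE) m QE)) S ->
  S = val (P0 *~ n + Q0 *~ m).
Proof.
move=> hS; apply: (red_uniq pl hS).
have red0 : red (regular_value t) (val (0 : ecurve nt)) (val (0 : ecurve nt')) by [].
have := red_addMz pl regular_aE regular_bE m
  (red_addMz pl regular_aE regular_bE n red0 red_P _) red_Q _.
rewrite !add0r val_ecD !val_ecMz; apply; exact/eqP.
Qed.

Lemma spec_injective (R1 R2 : point Qt) (S : point rat) :
  inM R1 -> inM R2 -> spec t R1 S -> spec t R2 S -> R1 = R2.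
Proof.
move=> [n1 [m1 ->]] [n2 [m2 ->]] /spec_combination -> /spec_combination/val_inj e.
have [/eqP en /eqP em] : n1 - n2 = 0 /\ m1 - m2 = 0.
  by apply: P0_Q0_free; rewrite !mulrzBr addrACA -opprD e subrr.
by rewrite !subr_eq0 in en em; rewrite (eqP en) (eqP em).
Qed.
End Specialization.

Unset Implicit Arguments.

Theorem theorem4p10 (t0 : rat) :
  fibre_elliptic t0 ->
  t0 \notin [:: -26; -19; -12; -11; -5; -3; -1; 6; 9; 44] ->
  (forall r : rat, r ^+ 3 + a0 t0 * r + b0 t0 != 0) ->
  forall R1 R2 : point Qt, inM R1 -> inM R2 ->
  forall S : point rat, spec t0 R1 S -> spec t0 R2 S -> R1 = R2.
Proof.
by move=> _ tE no_root0 R1 R2 i1 i2 S; apply: spec_injective.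
Qed.
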